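(* Let $T$ be a simplicial tree (not necessarily locally finite) and let $G \leq \mathrm{Aut}(T)$ be a countable group whose action on $T$ is minimal and of general type. Assume that for every half-tree $A$ of $T$ the fixator $G_A$ is non-trivial, and that there is some $\xi \in \partial T$ such that the stabilizer $G_\xi$ is amenable. Then $G$ has trivial amenable radical and is not $C^\ast$-simple.
   Context: All groups are regarded as discrete groups; in particular amenability and $C^\ast$-simplicity always refer to the discrete topology. A countable group $G$ is $C^\ast$-simple if its reduced $C^\ast$-algebra (the operator norm closure of the group algebra $\mathbf{C}[G]$ acting on $\ell^2(G)$ by the left-regular representation) has no non-trivial two-sided closed ideal. The amenable radical of $G$ is its largest amenable normal subgroup. $\partial T$ is the set of ends of $T$. A half-tree of $T$ is one of the two components obtained when removing an edge of $T$. For a subtree $A$ of $T$, the fixator $G_A$ is the set of elements of $G$ fixing $A$ pointwise. The action of $G$ on $T$ is minimal if there is no proper non-empty $G$-invariant subtree. An element $g \in \mathrm{Aut}(T)$ is hyperbolic if there is a bi-infinite geodesic line on which $g$ acts by a (non-trivial) translation; it then has exactly two fixed points in $\partial T$. The action of $G$ on $T$ is of general type if there exist two hyperbolic elements of $G$ without common fixed points in $\partial T$. *)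

(* Defs.v *)
From HB Require Import structures.
From mathcomp Require Import all_boot all_order all_algebra.
From mathcomp Require Import all_classical all_reals all_analysis.
From mathcomp Require Import complex lra.

Set Implicit Arguments.
Unset Strict Implicit.
Unset Printing Implicit Defensive.

Import Order.TTheory GRing.Theory Num.Theory.

Local Open Scope classical_set_scope.
Local Open Scope ring_scope.
Local Open Scope complex_scope.

(* A subgroup of a (possibly infinite) group [gT] is an element of the library
   type [groupClosed gT]; [subgrp H] is that subgroup seen as a group. *)
Section Subgroups.
Variable gT : groupType.

Definition subgrp (H : groupClosed gT) : Type := {x : gT | x \in H}.

Section Instances.
Variable H : groupClosed gT.

Fact subgrp_closed : group_closed [pred x : gT | x \in H].
Proof.
split=> [|x y xH yH]; first exact: gpred1.
by rewrite inE; apply: gpredM => //; rewrite gpredV.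
Qed.

HB.instance Definition _ := SubChoice.copy (subgrp H) {x : gT | x \in H}.
HB.instance Definition _ :=
  SubChoice_isSubGroup.Build gT [pred x : gT | x \in H] (subgrp H) subgrp_closed.
End Instances.

Definition triv_pred : {pred gT} := [pred x | x == 1%g].

Fact triv_pred_mul : mulg_closed triv_pred.
Proof. by move=> x y /eqP -> /eqP ->; rewrite inE mulg1. Qed.
Fact triv_pred_one : 1%g \in triv_pred.
Proof. by rewrite inE. Qed.
Fact triv_pred_inv : invg_closed triv_pred.
Proof. by move=> x /eqP ->; rewrite inE invg1. Qed.

HB.instance Definition _ := isMulClosed.Build gT triv_pred triv_pred_mul.
HB.instance Definition _ := isMul1Closed.Build gT triv_pred triv_pred_one.
HB.instance Definition _ := isInvClosed.Build gT triv_pred triv_pred_inv.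

Definition trivial_subgroup : groupClosed gT := triv_pred.

Definition normal_subgroup (N : groupClosed gT) :=
  forall n g : gT, n \in N -> (n ^ g)%g \in N.

End Subgroups.

Section Amenability.
Variable R : realType.

(* von Neumann's definition: a finitely additive probability measure on all
   subsets that is invariant under left translations. *)
Definition amenable (gT : groupType) :=
  exists mu : set gT -> R,
    [/\ forall A, 0 <= mu A,
        mu setT = 1,
        forall A B, A `&` B = set0 -> mu (A `|` B) = mu A + mu B
      & forall (g : gT) A, mu [set (g * a)%g | a in A] = mu A].

Definition is_amenable_radical (gT : groupType) (N : groupClosed gT) :=
  [/\ normal_subgroup N, amenable (subgrp N)
    & forall M : groupClosed gT, normal_subgroup M -> amenable (subgrp M) ->
        {subset M <= N}].

End Amenability.

Section SquareSummable.
Variables (R : realType) (gT : groupType).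

Definition sqnorm (f : gT -> R[i]^o) : \bar R :=
  (\esum_(x in [set: gT]) (Normc.normc (f x) ^+ 2)%:E)%E.

Definition l2_pred : {pred gT -> R[i]^o} := [pred f | (sqnorm f < +oo)%E].

Fact normc_sqD (u v : R[i]) :
  Normc.normc (u + v) ^+ 2 <= 2 * Normc.normc u ^+ 2 + 2 * Normc.normc v ^+ 2.
Proof.
case: u v => [a b] [c d] /=.
rewrite !sqr_sqrtr ?addr_ge0 ?sqr_ge0// -subr_ge0.
have -> : 2 * (a ^+ 2 + b ^+ 2) + 2 * (c ^+ 2 + d ^+ 2) -
    ((a + c) ^+ 2 + (b + d) ^+ 2) = (a - c) ^+ 2 + (b - d) ^+ 2.
  by rewrite !expr2; lra.
by rewrite addr_ge0 ?sqr_ge0.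
Qed.

Fact esumZ_le (c : R) (a : gT -> R) : 0 <= c -> (forall x, 0 <= a x) ->
  (\esum_(x in [set: gT]) (c * a x)%:E <=
     c%:E * \esum_(x in [set: gT]) (a x)%:E)%E.
Proof.
move=> c0 a0; apply: ub_ereal_sup => _ [A [finA _] <-].
under eq_fsbigr do rewrite EFinM.
rewrite -ge0_mule_fsumr; last by move=> x; rewrite lee_fin.
rewrite lee_wpmul2l ?lee_fin//.
by apply: ereal_sup_ubound; exists A.
Qed.

Fact l2_pred_closed : submod_closed l2_pred.
Proof.
have n2 (z : R[i]) : 0 <= Normc.normc z ^+ 2 by rewrite sqr_ge0.
split=> [|k f g].
  rewrite inE/= /sqnorm esum1 ?ltry// => x _.
  by rewrite Normc.normc0 expr0n.
rewrite !inE/= /sqnorm => f2 g2.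
apply: (@le_lt_trans _ _
  (\esum_(x in [set: gT])
     ((2 * Normc.normc k ^+ 2 * Normc.normc (f x) ^+ 2)%:E +
      (2 * Normc.normc (g x) ^+ 2)%:E))%E).
  apply: le_esum => x _; rewrite -EFinD lee_fin.
  apply: le_trans (normc_sqD _ _) _.
  by rewrite Normc.normcM exprMn mulrA.
rewrite esumD; last 2 first.
- by move=> x _; rewrite lee_fin; apply: mulr_ge0 (n2 _); exact: mulr_ge0.
- by move=> x _; rewrite lee_fin; exact: mulr_ge0.
have k0 : 0 <= 2 * Normc.normc k ^+ 2 by exact: mulr_ge0.
apply: lte_add_pinfty.
  apply: (le_lt_trans (esumZ_le k0 (fun x => n2 (f x)))).
  by apply: lte_mul_pinfty.
apply: (@le_lt_trans _ _ _ _ _ (esumZ_le _ (fun x => n2 (g x)))) => //.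
by apply: lte_mul_pinfty.
Qed.

HB.instance Definition _ :=
  GRing.isSubmodClosed.Build R[i] (gT -> R[i]^o) l2_pred l2_pred_closed.

Definition l2 : Type := {f : gT -> R[i]^o | f \in l2_pred}.

HB.instance Definition _ :=
  SubChoice.copy l2 {f : gT -> R[i]^o | f \in l2_pred}.
HB.instance Definition _ := [SubChoice_isSubLmodule of l2 by <:].

Definition l2norm (f : l2) : R := Num.sqrt (fine (sqnorm (val f))).

Fact lreg_subproof (g : gT) (f : l2) :
  (fun h => val f (g^-1 * h)%g) \in l2_pred.
Proof.
have := valP f; rewrite !inE/= /sqnorm.
rewrite (reindex_esum [set: gT] [set: gT] (fun h => g^-1 * h)%g)//.
split=> //.
- by move=> x y _ _; apply: mulgI.
- by move=> x _; exists (g * x)%g => //; rewrite mulKg.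
Qed.

Definition lreg (g : gT) : l2 -> l2 := fun f =>
  exist _ (fun h => val f (g^-1 * h)%g) (lreg_subproof g f).

Implicit Types (A B : l2 -> l2) (I J : set (l2 -> l2)).

Definition opnorm A : \bar R :=
  ereal_sup [set (l2norm (A f))%:E | f in [set f | l2norm f <= 1]].

Definition bounded_operator A := linear A /\ (opnorm A < +oo)%E.

Definition norm_closure I : set (l2 -> l2) :=
  [set A | bounded_operator A /\
     forall eps : R, 0 < eps ->
       exists2 B, I B & (opnorm (A - B)%R < eps%:E)%E].

(* The image of the group algebra in the left regular representation. *)
Definition group_algebra : set (l2 -> l2) :=
  [set A | exists s : seq (R[i] * gT), A = \sum_(x <- s) x.1 *: lreg x.2].

Definition reduced_Cstar_algebra := norm_closure group_algebra.

Definition closed_ideal I :=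
  [/\ I `<=` reduced_Cstar_algebra,
      I 0 /\ (forall (k : R[i]) A B, I A -> I B -> I (k *: A + B)),
      forall A B, reduced_Cstar_algebra A -> I B -> I (A \o B) /\ I (B \o A)
    & norm_closure I `<=` I].

Definition Cstar_simple :=
  forall I, closed_ideal I -> I = [set 0] \/ I = reduced_Cstar_algebra.

End SquareSummable.

(* Simplicial trees, given by their vertex set and adjacency relation; no local
   finiteness and no bound on the cardinality of the vertex set. *)
Record tree := Tree {
  vertex :> choiceType;
  adj : rel vertex;
  adj_sym : symmetric adj;
  adj_irr : irreflexive adj;
  tree_connected :
    forall x y : vertex, exists2 p, path adj x p & last x p = y;
  tree_acyclic : forall c : seq vertex, ucycle adj c -> (size c <= 2)%N }.
Arguments adj {t} : rename.

Section Automorphisms.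
Variable T : tree.

Definition aut_pred (f : T -> T) : bool :=
  `[< bijective f /\ forall x y, adj (f x) (f y) = adj x y >].

(* All automorphisms, inversions of edges included. *)
Definition aut : Type := {f : T -> T | aut_pred f}.

HB.instance Definition _ := SubChoice.copy aut {f : T -> T | aut_pred f}.

Definition aut_fun (g : aut) : T -> T := val g.
Coercion aut_fun : aut >-> Funclass.

Fact aut_one_subproof : aut_pred idfun.
Proof. by apply/asboolP; split=> //; exists idfun. Qed.

Fact aut_mul_subproof (f g : aut) : aut_pred (f \o g).
Proof.
have /asboolP[bf af] := valP f; have /asboolP[bg ag] := valP g.
apply/asboolP; split; first exact: bij_comp.
by move=> x y /=; rewrite af ag.
Qed.

Fact aut_inv_ex (g : aut) : exists2 h : T -> T, aut_pred h & cancel g h /\ cancel h g.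
Proof.
have /asboolP[[h gK hK] ag] := valP g.
exists h => //; apply/asboolP; split; first by exists (val g).
by move=> x y; rewrite -ag !hK.
Qed.

Definition aut_one : aut := exist _ idfun aut_one_subproof.
Definition aut_mul (f g : aut) : aut := exist _ (f \o g) (aut_mul_subproof f g).
Definition aut_inv (g : aut) : aut :=
  let: exist2 h hP _ := cid2 (aut_inv_ex g) in exist _ h hP.

Fact aut_mulA : associative aut_mul.
Proof. by move=> f g h; apply: val_inj. Qed.
Fact aut_mul1 : left_id aut_one aut_mul.
Proof. by move=> f; apply: val_inj. Qed.
Fact aut_1mul : right_id aut_one aut_mul.
Proof. by move=> f; apply: val_inj. Qed.
Fact aut_mulV : left_inverse aut_one aut_inv aut_mul.
Proof.
move=> g; apply: val_inj; apply/funext => x /=.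
by rewrite /aut_inv; case: cid2 => h hP [gK hK] /=; rewrite /aut_fun/= gK.
Qed.
Fact aut_Vmul : right_inverse aut_one aut_inv aut_mul.
Proof.
move=> g; apply: val_inj; apply/funext => x /=.
by rewrite /aut_inv; case: cid2 => h hP [gK hK] /=; rewrite hK.
Qed.

HB.instance Definition _ :=
  isGroup.Build aut aut_mulA aut_mul1 aut_1mul aut_mulV aut_Vmul.

End Automorphisms.

Section Trees.
Variable T : tree.
Implicit Types (A : set T) (xi : set (nat -> T)) (G : groupClosed (aut T)).

Definition ray (r : nat -> T) :=
  (forall n, adj (r n) (r n.+1)) /\ injective r.

Definition cofinal (r s : nat -> T) :=
  exists m n : nat, forall k, r (m + k)%N = s (n + k)%N.

(* An end is an equivalence class of rays. *)
Definition ends : set (set (nat -> T)) :=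
  [set [set s | ray s /\ cofinal r s] | r in ray].

Definition fixes_end (g : aut T) xi := [set g \o r | r in xi] = xi.

Definition stab_end G xi : {pred aut T} :=
  [pred g | (g \in G) && `[< fixes_end g xi >]].

Section StabEnd.
Variables (G : groupClosed (aut T)) (xi : set (nat -> T)).

Fact stab_end_mul : mulg_closed (stab_end G xi).
Proof.
move=> g h /andP[gG /asboolP gx] /andP[hG /asboolP hx].
apply/andP; split; first exact: gpredM.
apply/asboolP; rewrite /fixes_end -[RHS]gx -[in RHS]hx image_comp.
by apply: eq_imagel.
Qed.

Fact stab_end_one : 1%g \in stab_end G xi.
Proof.
apply/andP; split; first exact: gpred1.
by apply/asboolP; rewrite /fixes_end -[RHS]image_id.
Qed.

Fact stab_end_inv : invg_closed (stab_end G xi).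
Proof.
move=> g /andP[gG /asboolP gx]; apply/andP; split; first by rewrite gpredV.
apply/asboolP; rewrite /fixes_end -[in LHS]gx image_comp -[RHS]image_id.
apply: eq_imagel => r _; apply/funext => n /=.
by have /(congr1 (fun k : aut T => k (r n))) := mulVg g.
Qed.

HB.instance Definition _ :=
  isMulClosed.Build (aut T) (stab_end G xi) stab_end_mul.
HB.instance Definition _ :=
  isMul1Closed.Build (aut T) (stab_end G xi) stab_end_one.
HB.instance Definition _ :=
  isInvClosed.Build (aut T) (stab_end G xi) stab_end_inv.
End StabEnd.

Definition delete_edge (x y : T) : rel T :=
  [rel u v | adj u v && ((u, v) \notin [:: (x, y); (y, x)])].

(* The component of [x] once the edge [x, y] is removed; the component of [y] is
   obtained by exchanging [x] and [y]. *)
Definition half_tree A :=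
  exists x y : T, adj x y /\
    A = [set z | exists2 p, path (delete_edge x y) x p & last x p = z].

Definition fixator G A : set (aut T) :=
  [set g : aut T | g \in G /\ forall x, A x -> g x = x].

(* Subtrees are identified with their vertex sets. *)
Definition subtree A :=
  forall x y, A x -> A y ->
    exists2 p, path adj x p & last x p = y /\ (forall z, z \in p -> A z).

Definition minimal_action G :=
  forall A, A !=set0 -> subtree A ->
    (forall (g : aut T) x, g \in G -> A x -> A (g x)) -> A = setT.

Definition bi_infinite_geodesic (l : int -> T) :=
  (forall n, adj (l n) (l (n + 1))) /\ injective l.

Definition hyperbolic (g : aut T) :=
  exists l : int -> T, bi_infinite_geodesic l /\
    exists2 k : int, k != 0 & forall n, g (l n) = l (n + k).

Definition general_type G :=
  exists g h : aut T,
    [/\ g \in G, h \in G, hyperbolic g, hyperbolic h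
      & forall xi, ends xi -> ~ (fixes_end g xi /\ fixes_end h xi)].

End Trees.

(* Main.v *)
Require Import Defs.
From HB Require Import structures.
From mathcomp Require Import all_boot all_order all_algebra finmap.
From mathcomp Require Import all_classical all_reals all_analysis.
From mathcomp Require Import complex lra ring zify.

(* Not C*-simple: let g and h be non-trivial elements fixing pointwise the two
   half-trees of an edge. Every end of the orbit of xi lies in one of them, and g
   and h commute, so (1 - g)(1 - h) is non-zero but vanishes in the quasi-regular
   representation on G / G_xi. Since G_xi is amenable, this representation is
   dominated by the regular one, so its kernel is a proper closed ideal. Instead
   of Folner sets, a finite set F with |S F| < 2 |F| suffices: it bounds the
   matrix coefficients up to the factor 2, and exists since otherwise Hall's
   marriage theorem would give two injections with disjoint images moving points
   only by S, contradicting the invariant mean.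

   Amenable radical: let N be a non-trivial normal subgroup, and call a half-tree
   small if some element of N moves it off itself. An N-invariant mean on the
   vertices gives a small half-tree mass at most 1/2. Minimality gives a small
   half-tree and shows that every vertex lies in one, so that of two complementary
   half-trees at least one is small. If some half-tree were not small, the
   half-trees which are not small would point to an end fixed by G. Hence all
   half-trees have mass exactly 1/2, which is absurd for three disjoint ones at a
   branching vertex. *)

Set Implicit Arguments.
Unset Strict Implicit.
Unset Printing Implicit Defensive.

Import Order.TTheory GRing.Theory Num.Theory.

Local Open Scope classical_set_scope.
Local Open Scope ring_scope.

(** * Hall's theorem and amenability *)

Section Hall.
Variables V K : choiceType.
Local Open Scope fset_scope.
Implicit Types (A B : V -> {fset K}) (F : {fset V}).

Definition neighbours A F := \bigcup_(x <- F) A x.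

Definition hall A := forall F, (#|` F| <= #|` neighbours A F|)%N.

Lemma neighboursP A F y :
  reflect (exists2 x, x \in F & y \in A x) (y \in neighbours A F).
Proof.
apply: (iffP (bigfcupP _ _ _ _)) => [[x /andP[xF _] yA]|[x xF yA]]; exists x => //.
by rewrite xF.
Qed.

Lemma neighbours_sub A B F : (forall x, x \in F -> A x `<=` B x) ->
  neighbours A F `<=` neighbours B F.
Proof.
move=> AB; apply/fsubsetP => y /neighboursP[x xF yA].
by apply/neighboursP; exists x => //; apply: (fsubsetP (AB x xF)).
Qed.

(** The order is reversed, so that a maximal element for Zorn's lemma is a family that cannot be
    shrunk. *)
Let le_fam A B := `[< forall x, B x `<=` A x >].

(** At each [x] some member of the chain has the smallest set, since the sets are finite; these
    minima form the bound. On a finite [F] a single member of the chain realises all of them, so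
    Hall's condition survives. *)
Lemma hall_chain (C : set (V -> {fset K})) A0 : C A0 -> total_on C le_fam ->
  (forall A, C A -> hall A) ->
  exists2 B, hall B & forall A, C A -> le_fam A B.
Proof.
move=> CA0 totC hallC.
have min1 x : exists2 A, C A & forall A', C A' -> A x `<=` A' x.
  have n_ex : exists n, `[< exists2 A, C A & #|` A x| = n >].
    by exists #|` A0 x|; apply/asboolP; exists A0.
  have [m /asboolP[A CA <-] m_min] := ex_minnP n_ex.
  exists A => // A' CA'.
  have [/asboolP/(_ x) A'A|/asboolP//] := totC A A' CA CA'.
  have : A' x == A x.
    by rewrite eqEfcard A'A; apply: m_min; apply/asboolP; exists A'.
  by move=> /eqP ->.
have /choice[M /all_and2[CM minM]] x :
    exists A, C A /\ forall A', C A' -> A x `<=` A' x.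
  by have [A] := min1 x; exists A.
exists (fun x => M x x); last by move=> A CA; apply/asboolP => x; exact: minM.
move=> F.
have [A CA AF] : exists2 A, C A & forall x, x \in enum_fset F -> A x `<=` M x x.
  elim: (enum_fset F) => [|x s [A CA As]]; first by exists A0.
  have [/asboolP le|/asboolP le] := totC _ _ CA (CM x); last first.
    exists A => // y; rewrite inE => /predU1P[->|/As//]; exact: le.
  exists (M x) => // y; rewrite inE => /predU1P[->//|/As]; exact/fsubset_trans/le.
apply: leq_trans (hallC _ CA F) _; apply: fsubset_leq_card; exact: neighbours_sub.
Qed.

(** [V] may be infinite. Zorn's lemma gives a minimal Hall family below [A]; its sets are
    singletons, and Hall's condition on pairs makes the resulting map injective. *)
Lemma hall_marriage A : hall A ->
  exists2 f : V -> K, injective f & forall x, f x \in A x.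
Proof.
move=> hallA.
pose P := {B : V -> {fset K} | `[< hall B /\ le_fam A B >]}.
have le_refl B : le_fam B B by apply/asboolP.
have [| | | |] := @Zorn P (fun p q => le_fam (sval p) (sval q)).
- by move=> B.
- move=> B1 B2 B3 /asboolP B12 /asboolP B23; apply/asboolP => x.
  exact: fsubset_trans (B23 x) (B12 x).
- move=> [B1 h1] [B2 h2] /asboolP/= B12 /asboolP/= B21; apply/eq_exist/funext => x.
  by apply/eqP; rewrite eqEfsubset B12 B21.
- move=> C totC.
  have [[B0 CB0]|/set0P/negP/negPn/eqP C0] := pselect (C !=set0); last first.
    have pA : `[< hall A /\ le_fam A A >] by apply/asboolP.
    by exists (exist _ A pA) => s; rewrite C0.
  have [|||B hB CB] := @hall_chain [set sval B | B in C] (sval B0).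
  + by exists B0.
  + by move=> _ _ [B1 C1 <-] [B2 C2 <-]; apply: totC.
  + by move=> _ [[B1 /= h1] _ <-]; case/asboolP: h1.
  have pB : `[< hall B /\ le_fam A B >].
    apply/asboolP; split=> //; apply/asboolP => x.
    have /asboolP le0 := CB _ (ex_intro2 _ _ B0 CB0 erefl).
    have /asboolP[_ /asboolP leA] := svalP B0.
    exact: fsubset_trans (le0 x) (leA x).
  by exists (exist _ B pB) => p Cp; apply: CB; exists p.
move=> [B pB] Bmin; have /asboolP[hB /asboolP/= leAB] := pB.
(* Rado: in a minimal family satisfying Hall's condition, every set is a
   singleton, by submodularity of the number of neighbours. *)
have drop x a : a \in B x ->
    exists2 F, x \notin F & (#|` neighbours B F `|` (B x `\ a)| <= #|` F|)%N.
  move=> aBx.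
  (* By minimality, removing [a] from [B x] breaks Hall's condition. A violating set must contain
     [x]; the set wanted is what remains of it without [x]. *)
  pose B' z := if z == x then B x `\ a else B z.
  have B'B z : B' z `<=` B z.
    by rewrite /B'; case: eqP => [->|_]; rewrite ?fsubsetDl ?fsubset_refl.
  have /existsNP[F /negP] : ~ hall B'.
    move=> hB'.
    have pB' : `[< hall B' /\ le_fam A B' >].
      apply/asboolP; split=> //; apply/asboolP => z.
      exact: fsubset_trans (B'B z) (leAB z).
    have := Bmin (exist _ B' pB'); move/(_ (introT (asboolP _) B'B)) => [] B'E.
    by move: aBx; rewrite -B'E /B' eqxx !inE eqxx.
  rewrite -ltnNge => ltF.
  have xF : x \in F.
    apply: contraTT ltF => xF; rewrite -leqNgt; apply: leq_trans (hB F) _.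
    apply/fsubset_leq_card/neighbours_sub => z zF; rewrite /B'.
    by case: eqP zF xF => // -> ->.
  exists (F `\ x); first by rewrite !inE eqxx.
  have FE : #|` F| = #|` F `\ x|.+1 by rewrite (cardfsD1 x F) xF.
  rewrite -ltnS -FE; apply: leq_ltn_trans ltF; apply: fsubset_leq_card.
  apply/fsubsetP => y; rewrite inE => /orP[/neighboursP[z]|yB].
    rewrite !inE => /andP[zx zF] yz; apply/neighboursP; exists z => //.
    by rewrite /B' (negPf zx).
  by apply/neighboursP; exists x => //; rewrite /B' eqxx.
(* For [a] and [b] distinct, the union of the two enlarged neighbourhoods contains all neighbours of
   [x], [F] and [F'], and their intersection contains those of the common part of [F] and [F'].
   Hall's condition then gives |F| + |F'| + 1 <= |F| + |F'|. *)
have single x a b : a \in B x -> b \in B x -> a = b.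
  move=> aB bB; apply/eqP/negP => /negP ab.
  have [F xF leF] := drop x a aB; have [F' xF' leF'] := drop x b bB.
  have hU := hB (x |` (F `|` F')); have hI := hB (F `&` F').
  move: hU; rewrite cardfsU1 inE (negPf xF) (negPf xF') /= add1n => hU.
  have subU : neighbours B (x |` (F `|` F')) `<=`
      (neighbours B F `|` (B x `\ a)) `|` (neighbours B F' `|` (B x `\ b)).
    apply/fsubsetP => y /neighboursP[z]; rewrite !inE.
    case/predU1P => [->|/orP[zF|zF]] yz; last 2 first.
    - by have -> : y \in neighbours B F by apply/neighboursP; exists z.
    - have -> : y \in neighbours B F' by apply/neighboursP; exists z.
      by rewrite !orbT.
    rewrite yz !andbT; have [->|] := eqVneq y a; last by rewrite !orbT.
    by rewrite ab !orbT.
  have subI : neighbours B (F `&` F') `<=`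
      (neighbours B F `|` (B x `\ a)) `&` (neighbours B F' `|` (B x `\ b)).
    apply/fsubsetP => y /neighboursP[z]; rewrite !inE => /andP[zF zF'] yz.
    have -> : y \in neighbours B F by apply/neighboursP; exists z.
    by have -> : y \in neighbours B F' by apply/neighboursP; exists z.
  have := cardfsUI (neighbours B F `|` (B x `\ a)) (neighbours B F' `|` (B x `\ b)).
  have := cardfsUI F F'.
  move: (fsubset_leq_card subU) (fsubset_leq_card subI) => /=.
  lia.
have ex x : exists y, y \in B x.
  apply/fset0Pn; rewrite -cardfs_gt0; apply: leq_trans (_ : 1 <= _)%N => //.
  by have := hB [fset x]; rewrite cardfs1 /neighbours big_seq_fset1.
have [f fB] := choice ex.
exists f; last by move=> x; apply: (fsubsetP (leAB x)).
move=> x y fxy; apply/eqP/negP => /negP xy.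
have := hB [fset x; y]; rewrite cardfs2 xy.
suff /fsubset_leq_card : neighbours B [fset x; y] `<=` [fset f x].
  by rewrite cardfs1 leqNgt => /negP.
apply/fsubsetP => z /neighboursP[t]; rewrite !inE => /orP[]/eqP-> zB; apply/eqP.
  exact: single zB (fB x).
by rewrite fxy; apply: single zB (fB y).
Qed.
End Hall.

(** * Invariant means and finite sets of small doubling *)

Lemma mean_le1 (R : realType) (X : Type) (mu : set X -> R) :
  (forall A, 0 <= mu A) -> mu setT = 1 ->
  (forall A B, A `&` B = set0 -> mu (A `|` B) = mu A + mu B) ->
  forall A, mu A <= 1.
Proof.
move=> mu_ge0 muT muU A.
by have := muU _ _ (setICr A); rewrite setUCr muT; have := mu_ge0 (~` A); lra.
Qed.

Section Mean.
Variables (R : realType) (gT : groupType) (mu : set gT -> R).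
Hypothesis muU : forall A B, A `&` B = set0 -> mu (A `|` B) = mu A + mu B.
Hypothesis mul_mu : forall (g : gT) A, mu [set (g * a)%g | a in A] = mu A.

(** Cut the set according to the value of [f x * x^-1], one of finitely many: on each piece [f] is a
    left translation, and injectivity keeps the images disjoint. *)
Lemma mean_translation (f : gT -> gT) (s : seq gT) : injective f ->
  mu [set f x | x in [set x | (f x * x^-1)%g \in s]] =
  mu [set x | (f x * x^-1)%g \in s].
Proof.
move=> f_inj; elim: s => [|i s IH].
  rewrite (_ : [set x | _] = set0) ?image_set0//.
  by apply/seteqP; split=> // x; rewrite /= in_nil.
have [si|si] := boolP (i \in s).
  suff -> : [set x | (f x * x^-1)%g \in i :: s] = [set x | (f x * x^-1)%g \in s].
    by [].
  apply/seteqP; split=> x /=; rewrite inE; first by move=> /predU1P[->|].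
  by move=> ->; rewrite orbT.
set P := [set x | (f x * x^-1)%g = i].
set Q := [set x | (f x * x^-1)%g \in s] in IH *.
have PQ : P `&` Q = set0.
  by apply/seteqP; split=> // x [/= Px Qx]; move: si; rewrite -Px Qx.
have -> : [set x | (f x * x^-1)%g \in i :: s] = P `|` Q.
  apply/seteqP; split=> x /=; rewrite inE; first by move=> /predU1P.
  by move=> [->|->]; rewrite ?eqxx ?orbT.
rewrite image_setU !muU ?PQ//; last first.
  apply/seteqP; split=> // y [[x Px <-] [z Qz /f_inj zx]].
  by have : (P `&` Q) x; [split=> //; rewrite -zx | rewrite PQ].
rewrite IH -(mul_mu i P); congr (mu _ + _).
by apply: eq_imagel => x <-; rewrite mulgVK.
Qed.

End Mean.

Section Folner.
Variables (R : realType) (gT : groupType).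
Local Open Scope fset_scope.

Definition fset_mul (S F : {fset gT}) := [fset (s * x)%g | s in S, x in F].

Lemma amenable_doubling (S : {fset gT}) : amenable R gT ->
  exists2 F : {fset gT}, F != fset0 & (#|` fset_mul S F| < 2 * #|` F|)%N.
Proof.
move=> [mu [mu_ge0 muT muU mul_mu]]; apply: contrapT => noF.
pose A (x : gT * bool) := [fset (s * x.1)%g | s in S].
have hA : hall A.
  move=> F; pose F1 := [fset x.1 | x in F].
  (* The projection forgets only a boolean, so it at most halves the cardinality. *)
  have leF : (#|` F| <= 2 * #|` F1|)%N.
    pose F2 (b : bool) := [fset (x, b) | x in F1].
    have F2E b : #|` F2 b| = #|` F1| by rewrite card_imfset// => x y [].
    have : F `<=` F2 true `|` F2 false.
      apply/fsubsetP => -[x b] xF; rewrite inE -/(_ || _).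
      suff : (x, b) \in F2 b by case: b {xF} => ->; rewrite ?orbT.
      by apply/imfsetP; exists x => //; apply/imfsetP; exists (x, b).
    move/fsubset_leq_card/leq_trans; apply.
    by rewrite cardfsU !F2E mul2n -addnn leq_subr.
  have [F10|F10] := eqVneq F1 fset0.
    by rewrite F10 cardfs0 muln0 leqn0 in leF; rewrite (eqP leF).
  apply: leq_trans leF _; rewrite leqNgt; apply/negP => lt2; apply: noF.
  exists F1 => //; apply: leq_ltn_trans lt2; apply: fsubset_leq_card.
  apply/fsubsetP => y /imfset2P[s sS [x /imfsetP[z zF ->] ->]].
  by apply/neighboursP; exists z => //; apply/imfsetP; exists s.
have [f f_inj fA] := hall_marriage hA.
pose D b := [set f (x, b) | x in setT].
(* The displacement of either injection always lies in [S], so [mean_translation] applies to the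
   whole group. *)
have muD b : mu (D b) = 1.
  have fb_inj : injective (fun x => f (x, b)) by move=> x y /f_inj[].
  rewrite -muT; have := mean_translation muU mul_mu (enum_fset S) fb_inj.
  rewrite (_ : [set x | _] = setT)//; apply/seteqP; split=> // x _ /=.
  by have /imfsetP[s sS ->] := fA (x, b); rewrite mulgK.
have D0 : (D true `&` D false = set0)%classic.
  by apply/seteqP; split=> // y [[x _ <-] [z _ /f_inj]].
by have := mean_le1 mu_ge0 muT muU (D true `|` D false)%classic; rewrite muU// !muD; lra.
Qed.

End Folner.

(** * Bounded operators on l2 *)

(** Induction on [s]. The new cross term [2 * S * (x * y)] is at most [P * y ^+ 2 + Q * x ^+ 2], as
    seen by squaring and using [S ^+ 2 <= P * Q]. *)
Lemma cauchy_schwarz_sum (R : realFieldType) (I : Type) (s : seq I) (a b : I -> R) :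
  (\sum_(i <- s) a i * b i) ^+ 2 <=
  (\sum_(i <- s) a i ^+ 2) * (\sum_(i <- s) b i ^+ 2).
Proof.
have ge0 (f : I -> R) r : 0 <= \sum_(i <- r) f i ^+ 2.
  by apply: sumr_ge0 => i _; apply: sqr_ge0.
elim: s => [|i s]; first by rewrite !big_nil mul0r expr0n.
rewrite !big_cons.
move: (ge0 a s) (ge0 b s); move: (\sum_(_ <- s) _) (\sum_(_ <- s) _) (\sum_(_ <- s) _).
move=> S Q P P0 Q0; move: (a i) (b i) => x y SPQ.
have B0 : 0 <= P * y ^+ 2 + Q * x ^+ 2.
  by apply: addr_ge0; apply: mulr_ge0 => //; apply: sqr_ge0.
have sq : (2 * S * (x * y)) ^+ 2 <= (P * y ^+ 2 + Q * x ^+ 2) ^+ 2.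
  rewrite -subr_ge0 (_ : _ - _ = (P * y ^+ 2 - Q * x ^+ 2) ^+ 2 +
    4 * ((P * Q - S ^+ 2) * (x * y) ^+ 2)); last by ring.
  apply: addr_ge0; first exact: sqr_ge0.
  by apply: mulr_ge0 => //; apply: mulr_ge0; rewrite ?subr_ge0 ?sqr_ge0.
have {}sq : 2 * S * (x * y) <= P * y ^+ 2 + Q * x ^+ 2.
  rewrite leNgt; apply/negP => lt; move: sq; rewrite leNgt => /negP; apply.
  by rewrite ltr_pXn2r ?nnegrE// (le_trans B0)// ltW.
rewrite -subr_ge0 (_ : _ - _ = (P * Q - S ^+ 2) +
  (P * y ^+ 2 + Q * x ^+ 2 - 2 * S * (x * y))); last by ring.
by rewrite addr_ge0// subr_ge0.
Qed.

Section L2.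
Variables (R : realType) (gT : groupType).
Local Notation C := R[i].
Local Notation normc := Normc.normc.
Implicit Types (f g : l2 R gT) (A B : l2 R gT -> l2 R gT) (s t : seq (C * gT)).

Lemma sqnorm_ge0 (u : gT -> R[i]^o) : (0 <= sqnorm u)%E.
Proof. by apply: esum_ge0 => x _; rewrite lee_fin sqr_ge0. Qed.

Lemma l2norm_ge0 f : 0 <= l2norm f.
Proof. exact: sqrtr_ge0. Qed.

Lemma sqnormE f : sqnorm (val f) = (l2norm f ^+ 2)%:E.
Proof.
have f_fin : sqnorm (val f) \is a fin_num.
  by rewrite ge0_fin_numE ?sqnorm_ge0//; have := valP f; rewrite inE.
by rewrite /l2norm sqr_sqrtr ?fineK// fine_ge0 ?sqnorm_ge0.
Qed.

Lemma l2norm_ge_sum f (r : seq gT) : uniq r ->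
  \sum_(x <- r) normc (val f x) ^+ 2 <= l2norm f ^+ 2.
Proof.
move=> r_uniq; rewrite -lee_fin -sqnormE -sumEFin; apply: ereal_sup_ubound.
by exists [set` r]; [split=> //; apply: finite_seq | rewrite -fsbig_seq].
Qed.

Lemma sqnorm_le_sum (u : gT -> R[i]^o) (c : R) :
  (forall r : seq gT, uniq r -> \sum_(x <- r) normc (u x) ^+ 2 <= c) ->
  (sqnorm u <= c%:E)%E.
Proof.
move=> uc; apply: ub_ereal_sup => _ [A [finA _] <-].
by rewrite fsbig_finite//= sumEFin lee_fin; apply: uc; apply: fset_uniq.
Qed.

Lemma l2norm_le_sum f (c : R) : 0 <= c ->
  (forall r : seq gT, uniq r -> \sum_(x <- r) normc (val f x) ^+ 2 <= c ^+ 2) ->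
  l2norm f <= c.
Proof.
move=> c0 /sqnorm_le_sum; rewrite sqnormE lee_fin ler_pXn2r ?nnegrE//.
exact: l2norm_ge0.
Qed.

Lemma normc_ge0 (z : C) : 0 <= normc z.
Proof. by case: z => a b; apply: sqrtr_ge0. Qed.

Lemma normc_sum (I : Type) (r : seq I) (P : pred I) (F : I -> C) :
  normc (\sum_(i <- r | P i) F i) <= \sum_(i <- r | P i) normc (F i).
Proof.
elim/big_ind2: _ => [|x1 x2 y1 y2 h1 h2|//]; first by rewrite Normc.normc0.
by apply: le_trans (le_normcD _ _) _; apply: lerD.
Qed.

(** Minkowski's inequality on finite sets, with the cross term bounded by Cauchy-Schwarz. *)
Lemma l2normD f g : l2norm (f + g) <= l2norm f + l2norm g.
Proof.
have f0 := l2norm_ge0 f; have g0 := l2norm_ge0 g.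
apply: l2norm_le_sum; first exact: addr_ge0.
move=> r r_uniq; have fr := l2norm_ge_sum f r_uniq; have gr := l2norm_ge_sum g r_uniq.
have cs := cauchy_schwarz_sum r (fun x => normc (val f x)) (fun x => normc (val g x)).
set S := \sum_(i <- r) _ * _ in cs.
have S_le : S <= l2norm f * l2norm g.
  rewrite leNgt; apply/negP => lt; move: cs; rewrite leNgt => /negP; apply.
  apply: (@le_lt_trans _ _ ((l2norm f * l2norm g) ^+ 2)).
    by rewrite exprMn; apply: ler_pM => //; apply: sumr_ge0 => x _; apply: sqr_ge0.
  by rewrite ltr_pXn2r ?nnegrE ?mulr_ge0// (le_trans _ (ltW lt)) ?mulr_ge0.
apply: (@le_trans _ _ (\sum_(x <- r) normc (val f x) ^+ 2 + 2 * S +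
    \sum_(x <- r) normc (val g x) ^+ 2)); last by rewrite sqrrD; lra.
rewrite /S mulr_sumr -!big_split /=; apply: ler_sum => x _.
apply: (@le_trans _ _ ((normc (val f x) + normc (val g x)) ^+ 2)).
  by rewrite ler_pXn2r ?nnegrE ?addr_ge0 ?normc_ge0//; apply: le_normcD.
by rewrite sqrrD -mulr_natl.
Qed.

Lemma l2normZ_le (k : C) f : l2norm (k *: f) <= normc k * l2norm f.
Proof.
apply: l2norm_le_sum; first by rewrite mulr_ge0 ?normc_ge0 ?l2norm_ge0.
move=> r r_uniq; rewrite exprMn.
apply: le_trans (ler_wpM2l (sqr_ge0 _) (l2norm_ge_sum f r_uniq)).
rewrite mulr_sumr; apply: ler_sum => x _.
by rewrite -exprMn -Normc.normcM.
Qed.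

Lemma l2norm_lreg (g : gT) f : l2norm (lreg g f) = l2norm f.
Proof.
rewrite /l2norm; congr (Num.sqrt (fine _)).
rewrite [RHS]/sqnorm (reindex_esum [set: gT] [set: gT] (fun h => g^-1 * h)%g)//.
split=> //; first by move=> x y _ _; apply: mulgI.
by move=> x _; exists (g * x)%g => //; rewrite mulKg.
Qed.

Lemma l2norm0 : l2norm (0 : l2 R gT) = 0.
Proof.
apply/eqP; rewrite eq_le l2norm_ge0 andbT -(mul0r (l2norm (0 : l2 R gT))).
by rewrite -{1}(scale0r (0 : l2 R gT)) -(Normc.normc0 R) l2normZ_le.
Qed.

Lemma ind_sum (E : {fset gT}) (r : seq gT) : uniq r ->
  \sum_(x <- r) normc ((x \in E)%:R : C) ^+ 2 <= #|` E|%:R :> R.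
Proof.
move=> r_uniq; rewrite (eq_bigr (fun x => (x \in E)%:R)); last first.
  by move=> x _; case: (x \in E); rewrite ?Normc.normc1 ?Normc.normc0 ?expr1n ?expr0n.
rewrite -natr_sum ler_nat.
rewrite (eq_bigr (fun x => if x \in E then 1%N else 0%N)); last by move=> x _; case: ifP.
rewrite -big_mkcond sum1_count -size_filter; apply: uniq_leq_size.
  exact: filter_uniq.
by move=> x; rewrite mem_filter => /andP[].
Qed.

Lemma ind_subproof (E : {fset gT}) :
  (fun x => (x \in E)%:R : R[i]^o) \in @l2_pred R gT.
Proof. by rewrite inE; apply: le_lt_trans (sqnorm_le_sum (@ind_sum E)) (ltry _). Qed.

Definition ind (E : {fset gT}) : l2 R gT :=
  exist _ (fun x => (x \in E)%:R) (ind_subproof E).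

Lemma l2norm_ind E : l2norm (ind E) ^+ 2 <= #|` E|%:R.
Proof. by rewrite -lee_fin -sqnormE; apply: sqnorm_le_sum; apply: ind_sum. Qed.

(** The left regular representation of the group algebra, an element of which is given by a list of
    coefficients and group elements, repetitions allowed. *)
Definition lambda s : l2 R gT -> l2 R gT := \sum_(x <- s) x.1 *: lreg x.2.

Lemma lambdaE s f z : val (lambda s f) z = \sum_(x <- s) x.1 * val f (x.2^-1 * z)%g.
Proof.
rewrite /lambda; elim: s => [|x s IH]; first by rewrite !big_nil.
by rewrite !big_cons -IH.
Qed.

(** A real bound standing in for the extended real [opnorm]; for linear operators the two agree by
    [opnorm_le] and [bdd_opnorm]. *)
Definition bdd A (c : R) := 0 <= c /\ forall f, l2norm (A f) <= c * l2norm f.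

Lemma bddD A B a b : bdd A a -> bdd B b -> bdd (A + B) (a + b).
Proof.
move=> [a0 Aa] [b0 Bb]; split=> [|f]; first exact: addr_ge0.
by apply: le_trans (l2normD _ _) _; rewrite mulrDl lerD.
Qed.

Lemma bddZ (k : C) A a : bdd A a -> bdd (k *: A) (normc k * a).
Proof.
move=> [a0 Aa]; split=> [|f]; first by rewrite mulr_ge0 ?normc_ge0.
apply: le_trans (l2normZ_le _ _) _.
by rewrite -mulrA ler_wpM2l ?normc_ge0.
Qed.

Lemma bddN A a : bdd A a -> bdd (- A) a.
Proof.
move=> /(bddZ (-1)); rewrite scaleN1r.
by rewrite (_ : normc (-1 : C) = 1) ?mul1r//= oppr0 sqrrN expr1n expr0n addr0 sqrtr1.
Qed.

Lemma bddB A B a b : bdd A a -> bdd B b -> bdd (A - B) (a + b).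
Proof. by move=> Aa /bddN; apply: bddD. Qed.

Lemma bdd_comp A B a b : bdd A a -> bdd B b -> bdd (A \o B) (a * b).
Proof.
move=> [a0 Aa] [b0 Bb]; split=> [|f]; first exact: mulr_ge0.
by apply: le_trans (Aa _) _; rewrite -mulrA ler_wpM2l.
Qed.

Lemma bdd_le A a b : a <= b -> bdd A a -> bdd A b.
Proof.
move=> ab [a0 Aa]; split=> [|f]; first exact: le_trans ab.
by apply: le_trans (Aa f) _; rewrite ler_wpM2r ?l2norm_ge0.
Qed.

Lemma bdd0 : bdd 0 0.
Proof. by split=> // f; rewrite mul0r l2norm0. Qed.

Lemma bdd_lambda s : bdd (lambda s) (\sum_(x <- s) normc x.1).
Proof.
rewrite /lambda; elim: s => [|x s IH]; first by rewrite !big_nil; apply: bdd0.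
rewrite !big_cons; apply: bddD IH; rewrite -[X in bdd _ X]mulr1; apply: bddZ.
by split=> // f; rewrite l2norm_lreg mul1r.
Qed.

Lemma opnorm_le A c : bdd A c -> (opnorm A <= c%:E)%E.
Proof.
move=> [c0 Ac]; apply: ub_ereal_sup => _ [f f1 <-]; rewrite lee_fin.
by apply: le_trans (Ac f) _; rewrite ler_piMr.
Qed.

Lemma bdd_opnorm A c : linear A -> (opnorm A <= c%:E)%E -> bdd A c.
Proof.
move=> Alin Ac.
have Ac1 f : l2norm f <= 1 -> l2norm (A f) <= c.
  by move=> f1; rewrite -lee_fin; apply: le_trans Ac; apply: ereal_sup_ubound; exists f.
have c0 : 0 <= c.
  by apply: le_trans (l2norm_ge0 (A 0)) _; apply: Ac1; rewrite l2norm0.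
split=> // f; apply/ler_addgt0Pr => e e0.
(* Dividing by [l2norm f + d] instead of [l2norm f] covers the vectors of norm zero; this [d] keeps
   the error [d * c] below [e]. *)
pose d := e / (c + 1); have d0 : 0 < d by rewrite divr_gt0// ltr_wpDl.
have fd0 : 0 < l2norm f + d by rewrite ltr_wpDl ?l2norm_ge0.
pose k : C := (l2norm f + d)%:C%C.
have nk : normc k = l2norm f + d.
  by rewrite /= expr0n addr0 sqrtr_sqr ger0_norm// ltW.
have nkV : normc k^-1 = (l2norm f + d)^-1 by rewrite Normc.normcV nk.
have k0 : k != 0 by apply: contraTneq fd0 => k0; rewrite -nk k0 Normc.normc0 ltxx.
have Ak g : A (k *: g) = k *: A g.
  have A0 : A 0 = 0 by have := Alin (-1) 0 0; rewrite scaler0 addr0 scaleN1r addNr.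
  by have := Alin k g 0; rewrite A0 !addr0.
have -> : A f = k *: A (k^-1 *: f) by rewrite -Ak scalerA divff// scale1r.
apply: le_trans (l2normZ_le _ _) _; rewrite nk.
apply: (@le_trans _ _ ((l2norm f + d) * c)).
  rewrite ler_pM2l//; apply: Ac1; apply: le_trans (l2normZ_le _ _) _.
  by rewrite nkV mulrC ler_pdivrMr// mul1r lerDl ltW.
rewrite mulrDl (mulrC _ c) lerD2l /d mulrAC ler_pdivrMr ?ltr_wpDl//.
by rewrite ler_pM2l// lerDl.
Qed.

End L2.

(** * The kernel of a quasi-regular representation *)

Section QuasiRegular.
Variables (R : realType) (gT : groupType) (H : groupClosed gT).
Local Notation C := R[i].
Local Notation normc := Normc.normc.
Local Notation l2T := (l2 R gT).
Implicit Types (f : l2T) (A B : l2T -> l2T) (s t : seq (C * gT)) (u v : gT).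

(** The matrix coefficient of [s] at the cosets of [u] and [v] in the quasi-regular representation:
    [x.2] sends [u H] to [v H] exactly when [v^-1 * x.2 * u] lies in [H]. *)
Definition coef u v s : C := \sum_(x <- s | (v^-1 * x.2 * u)%g \in H) x.1.

Hypothesis H_doubling : forall S : {fset gT}, {subset S <= H} ->
  exists F : {fset gT}, [/\ {subset F <= H}, F != fset0 &
    (#|` fset_mul S F| < 2 * #|` F|)%N].

(* Pair lambda s applied to the indicator of u F with the indicator of v S F. *)
Lemma coef_le u v s c : bdd (lambda s) c -> normc (coef u v s) <= 2 * c.
Proof.
move=> [c0 bc].
pose S := [fset (v^-1 * x.2 * u)%g | x in s & (v^-1 * x.2 * u)%g \in H]%fset.
have [|F [FH F0 SF]] := H_doubling (S := S).
  by move=> _ /imfsetP[x /= /[!inE] /andP[_ xH] ->].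
pose uF := [fset (u * h)%g | h in F]%fset.
pose vSF := [fset (v * h)%g | h in fset_mul S F]%fset.
have cuF : #|` uF| = #|` F| by rewrite card_imfset//; apply: mulgI.
have cvSF : #|` vSF| = #|` fset_mul S F| by rewrite card_imfset//; apply: mulgI.
pose g := lambda s (ind R uF).
(* If [w = v^-1 * x.2 * u] is in [H], then [x.2] carries [u F] onto [v w F], inside [v S F], and the
   term counts |F| times. Otherwise the translate of [u F] misses [v H], hence [v S F]. *)
have sum_g : \sum_(z <- vSF) val g z = #|` F|%:R * coef u v s.
  under eq_bigr do rewrite lambdaE.
  rewrite exchange_big /= /coef mulr_sumr [RHS]big_mkcond /= big_seq [RHS]big_seq.
  apply: eq_bigr => x xs; rewrite -mulr_sumr.
  case: ifPn => xH; last first.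
    rewrite big_seq big1 ?mulr0// => z /imfsetP[h /= hSF ->].
    case: imfsetP => // -[k /= kF] e; case/negP: xH.
    have /imfset2P[a /= aS [b bF hab]] := hSF.
    have aH : a \in H by case/imfsetP: aS => y /= /[!inE] /andP[_ yH] ->.
    have -> : (v^-1 * x.2 * u)%g = (h * k^-1)%g.
      apply: (@mulIg _ k); by rewrite mulgVK -!mulgA -e mulVKg mulKg.
    have kH : k \in H by apply: FH.
    have bH : b \in H by apply: FH.
    by rewrite hab; apply: gpredF => //; apply: gpredM.
  rewrite mulrC; congr (_ * _).
  pose w := (v^-1 * x.2 * u)%g.
  have wS : w \in S by apply/imfsetP; exists x => //=; rewrite inE xs.
  pose zF := [fset (x.2 * (u * h))%g | h in F]%fset.
  have czF : #|` zF| = #|` F| by rewrite card_imfset// => a b /mulgI/mulgI.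
  have eqz z : (x.2^-1 * z \in uF)%g = (z \in zF).
    apply/imfsetP/imfsetP => /= -[h hF e]; exists h => //.
      by rewrite -e mulVKg.
    by rewrite e mulKg.
  rewrite (eq_bigr (fun z => if z \in zF
    then 1 else 0)); last first.
    by move=> z _; rewrite [LHS]/= eqz; case: ifP.
  rewrite -big_mkcond /=.
  have sub : (zF `<=` vSF)%fset.
    apply/fsubsetP => _ /imfsetP[h /= hF ->]; apply/imfsetP => /=.
    exists (w * h)%g; first by apply/imfset2P; exists w => //; exists h.
    by rewrite /w -!mulgA mulVKg.
  rewrite -big_filter big_const_seq count_predT iter_addr_0.
  suff -> : size [seq z <- vSF | z \in zF] = #|` F| by [].
  rewrite -czF; apply/perm_size/uniq_perm; rewrite ?fset_uniq ?filter_uniq// => z.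
  by rewrite mem_filter; case: (boolP (z \in zF)) => //= /(fsubsetP sub) ->.
have cF0 : 0 < #|` F|%:R :> R by rewrite ltr0n cardfs_gt0.
have := normc_sum vSF xpredT (val g); rewrite sum_g Normc.normcM.
have -> : normc (#|` F|%:R : C) = #|` F|%:R.
  by rewrite -(rmorph_nat (real_complex R)) /= expr0n addr0 sqrtr_sqr ger0_norm// ltW.
move=> le1.
have := cauchy_schwarz_sum vSF (fun=> 1) (fun z => normc (val g z)).
under eq_bigr do rewrite mul1r.
under [X in _ <= X * _]eq_bigr do rewrite expr1n.
rewrite big_const_seq count_predT iter_addr_0 => le2.
have le3 := l2norm_ge_sum g (fset_uniq vSF).
have le4 : l2norm g ^+ 2 <= c ^+ 2 * #|` F|%:R.
  apply: (@le_trans _ _ ((c * l2norm (ind R uF)) ^+ 2)).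
    by rewrite ler_pXn2r ?nnegrE ?mulr_ge0 ?l2norm_ge0//; apply: bc.
  by rewrite exprMn ler_wpM2l ?sqr_ge0// -cuF l2norm_ind.
have le5 : (#|` vSF|%:R : R) <= 2 * #|` F|%:R by rewrite -natrM ler_nat cvSF ltnW.
set n := normc _ in le1 *.
have n0 : 0 <= n by apply: normc_ge0.
(* The bounds combine to [n ^+ 2 <= 2 * c ^+ 2], weakened to the square of [2 * c] to avoid a square
   root. *)
have : (#|` F|%:R * n) ^+ 2 <= (#|` F|%:R * (2 * c)) ^+ 2.
  apply: (@le_trans _ _ ((\sum_(z <- vSF) normc (val g z)) ^+ 2)).
    have sum0 : 0 <= \sum_(z <- vSF) normc (val g z).
      by apply: sumr_ge0 => z _; apply: normc_ge0.
    by rewrite ler_pXn2r ?nnegrE// mulr_ge0// ltW.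
  apply: le_trans le2 _.
  apply: (@le_trans _ _ ((2 * #|` F|%:R) * (c ^+ 2 * #|` F|%:R))).
    apply: ler_pM => //.
      by apply: sumr_ge0 => z _; apply: sqr_ge0.
    exact: le_trans le3 le4.
  rewrite -subr_ge0 (_ : _ - _ = 2 * (#|` F|%:R * c) ^+ 2); last by ring.
  by rewrite mulr_ge0// sqr_ge0.
by rewrite ler_pXn2r ?nnegrE ?mulr_ge0 ?(ltW cF0)// ler_pM2l.
Qed.

Definition scale_comb (k : C) s := [seq (k * x.1, x.2) | x <- s].
Definition mul_comb s t := [seq (x.1 * y.1, (x.2 * y.2)%g) | x <- s, y <- t].

Lemma lambda_cat s t : lambda (s ++ t) = lambda s + lambda t.
Proof. exact: big_cat. Qed.

Lemma lambda_scale k s : lambda (scale_comb k s) = k *: lambda s.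
Proof.
rewrite /lambda big_map scaler_sumr; apply: eq_bigr => x _.
by rewrite scalerA.
Qed.

Lemma coef_cat u v s t : coef u v (s ++ t) = coef u v s + coef u v t.
Proof. exact: big_cat. Qed.

Lemma coef_scale u v k s : coef u v (scale_comb k s) = k * coef u v s.
Proof. by rewrite /coef big_map mulr_sumr. Qed.

Lemma lambda_linear s : linear (lambda s).
Proof.
move=> k f g; apply: val_inj; apply/funext => z.
rewrite lambdaE [RHS](_ : _ = k * val (lambda s f) z + val (lambda s g) z)//.
rewrite !lambdaE mulr_sumr -big_split; apply: eq_bigr => x _ /=.
rewrite -[(k *: _ + _) _]/(k * val f (x.2^-1 * z)%g + val g (x.2^-1 * z)%g).
by rewrite mulrDr mulrCA.
Qed.

Lemma lambda_mul s t : lambda (mul_comb s t) = lambda s \o lambda t.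
Proof.
apply/funext => f; apply: val_inj; apply/funext => z /=.
rewrite !lambdaE big_allpairs_dep; apply: eq_bigr => x _ /=.
rewrite lambdaE mulr_sumr; apply: eq_bigr => y _ /=.
by rewrite invgM !mulgA mulrA.
Qed.

(** Multiplying by a group element on the left only shifts the index [v], and on the right, in
    [coef_mulr], the index [u]. *)
Lemma coef_mull u v s t :
  coef u v (mul_comb s t) = \sum_(x <- s) x.1 * coef u (x.2^-1 * v)%g t.
Proof.
rewrite /coef big_mkcond big_allpairs_dep; apply: eq_bigr => x _ /=.
rewrite -big_mkcond -mulr_sumr; congr (_ * _).
by apply: eq_bigl => y; rewrite invgM invgK !mulgA.
Qed.

Lemma coef_mulr u v s t :
  coef u v (mul_comb s t) = \sum_(y <- t) y.1 * coef (y.2 * u)%g v s.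
Proof.
rewrite /coef big_mkcond big_allpairs_dep exchange_big; apply: eq_bigr => y _ /=.
rewrite -big_mkcond mulr_sumr; apply: eq_big => x; first by rewrite !mulgA.
by rewrite mulrC.
Qed.

Let cstar : set (l2T -> l2T) := @reduced_Cstar_algebra R gT.

Lemma bounded_operatorP A :
  bounded_operator A <-> linear A /\ exists c, bdd A c.
Proof.
split=> [[Alin Afin]|[Alin [c Ac]]]; split=> //.
  case E : (opnorm A) => [c||]; last 2 first.
  - by rewrite E in Afin.
  - by exists 0; apply: bdd_opnorm => //; rewrite E leNye.
  by exists c; apply: bdd_opnorm => //; rewrite E.
exact: le_lt_trans (opnorm_le Ac) (ltry _).
Qed.

Lemma linearB A B : linear A -> linear B -> linear (A - B).
Proof.
move=> Alin Blin k f g; rewrite -[LHS]/(A (k *: f + g) - B (k *: f + g)).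
by rewrite Alin Blin opprD addrACA -scalerN -scalerDr.
Qed.

Lemma cstarP A : cstar A <-> [/\ linear A, exists c, bdd A c
  & forall e : R, 0 < e -> exists s, bdd (A - lambda s) e].
Proof.
split=> [[/bounded_operatorP[Alin Abdd] Acl]|[Alin Abdd Acl]].
  split=> // e /Acl[B [s ->] lte]; exists s.
  by apply: bdd_opnorm (ltW lte); apply: linearB Alin (lambda_linear s).
split=> [|e e0]; first exact/bounded_operatorP.
(* Half of [e], because [norm_closure] asks for a strict inequality. *)
have [s As] := Acl (e / 2) (divr_gt0 e0 (ltr0n _ 2)).
exists (lambda s); first by exists s.
by apply: le_lt_trans (opnorm_le As) _; rewrite lte_fin; lra.
Qed.

Lemma cstar_lambda s : cstar (lambda s).
Proof.
apply/cstarP; split; first exact: lambda_linear.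
  by exists (\sum_(x <- s) normc x.1); apply: bdd_lambda.
by move=> e e0; exists s; rewrite subrr; apply: bdd_le (ltW e0) (bdd0 _ _).
Qed.

(* The kernel of the quasi-regular representation of the reduced C*-algebra on
   l2(gT / H): all matrix coefficients vanish. *)
Definition coef_ideal : set (l2T -> l2T) := [set A | cstar A /\
  forall u v s c, bdd (A - lambda s) c -> normc (coef u v s) <= 2 * c].

(** Two approximants of [A] are close to each other in norm, so by [coef_le] their coefficients are
    close too; it is enough to control one approximant for each [u], [v] and [e]. *)
Lemma coef_idealI A : cstar A -> (forall u v e, 0 < e ->
    exists2 t, bdd (A - lambda t) e & normc (coef u v t) <= e) ->
  coef_ideal A.
Proof.
move=> csA approx; split=> // u v s c Asc; apply/ler_addgt0Pr => e e0.
(* The final estimate is [2 * (e / 3 + c) + e / 3 = 2 * c + e]. *)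
have e30 : 0 < e / 3 by rewrite divr_gt0.
have [t At ct] := approx u v (e / 3) e30.
have : bdd (lambda (s ++ scale_comb (-1) t)) (e / 3 + c).
  rewrite lambda_cat lambda_scale scaleN1r.
  have -> : lambda s - lambda t = (A - lambda t) - (A - lambda s).
    by rewrite opprB [RHS]addrC subrKA.
  exact: bddB.
move=> /(coef_le u v); rewrite coef_cat coef_scale mulN1r => le1.
have -> : coef u v s = (coef u v s - coef u v t) + coef u v t by rewrite subrK.
by apply: le_trans (le_normcD _ _) _; lra.
Qed.

(** One [t] serves all [u] and [v]; products need this, since they shift the indices. *)
Lemma coef_ideal_approx A e : coef_ideal A -> 0 < e -> exists t,
  bdd (A - lambda t) e /\ forall u v, normc (coef u v t) <= 2 * e.
Proof.
move=> [/cstarP[_ _ Acl] Acoef] e0; have [t At] := Acl e e0.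
by exists t; split=> // u v; apply: Acoef.
Qed.

Lemma cstar_comb (k : C) A B : cstar A -> cstar B -> cstar (k *: A + B).
Proof.
move=> /cstarP[Alin [a Aa] Acl] /cstarP[Blin [b Bb] Bcl]; apply/cstarP; split.
- move=> c f g; rewrite -[LHS]/(k *: A (c *: f + g) + B (c *: f + g)).
  rewrite Alin Blin scalerDr addrACA; congr (_ + _).
  by rewrite !scalerA mulrC -scalerA -scalerDr.
- by exists (normc k * a + b); apply: bddD Bb; apply: bddZ.
- move=> e e0; pose d := e / (normc k + 1).
  have k1 : 0 < normc k + 1 by rewrite ltr_wpDl ?normc_ge0.
  have [s As] := Acl d (divr_gt0 e0 k1); have [t Bt] := Bcl d (divr_gt0 e0 k1).
  exists (scale_comb k s ++ t); rewrite lambda_cat lambda_scale opprD addrACA -scalerBr.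
  have -> : e = normc k * d + d by rewrite /d; field; rewrite gt_eqF.
  by apply: bddD Bt; apply: bddZ.
Qed.

(** Here [s] can be chosen first and [t] with a precision depending on [s]; [comp_sub_lambda_r]
    allows the opposite order. *)
Lemma comp_sub_lambda_l A B s t :
  A \o B - lambda (mul_comb s t) =
  ((A - lambda s) \o B) + (lambda s \o (B - lambda t)).
Proof.
rewrite lambda_mul; apply/funext => f.
rewrite -[LHS]/(A (B f) - lambda s (lambda t f)).
rewrite -[RHS]/(A (B f) - lambda s (B f) + lambda s (B f - lambda t f)).
rewrite (addrC (B f)) -(scaleN1r (lambda t f)) lambda_linear scaleN1r.
by rewrite (addrC (- _)) addrA subrK.
Qed.

Lemma comp_sub_lambda_r A B s t : linear A ->
  A \o B - lambda (mul_comb s t) =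
  (A \o (B - lambda t)) + ((A - lambda s) \o lambda t).
Proof.
move=> Alin; rewrite lambda_mul; apply/funext => f.
rewrite -[LHS]/(A (B f) - lambda s (lambda t f)).
rewrite -[RHS]/(A (B f - lambda t f) + (A (lambda t f) - lambda s (lambda t f))).
rewrite (addrC (B f)) -(scaleN1r (lambda t f)) Alin scaleN1r.
by rewrite (addrC (- _)) addrA subrK.
Qed.

Let small_mul (e b : R) : 0 < e -> 0 <= b -> exists2 d, 0 < d & d * b <= e.
Proof.
move=> e0 b0; have b1 : 0 < b + 1 by rewrite ltr_wpDl.
exists (e / (b + 1)); first exact: divr_gt0.
by rewrite mulrAC ler_pdivrMr// ler_pM2l// lerDl.
Qed.

Lemma cstar_comp A B : cstar A -> cstar B -> cstar (A \o B).
Proof.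
move=> /cstarP[Alin [a Aa] Acl] /cstarP[Blin [b Bb] Bcl]; apply/cstarP; split.
- by move=> k f g /=; rewrite Blin Alin.
- by exists (a * b); apply: bdd_comp.
move=> e e0; have e20 : 0 < e / 2 by rewrite divr_gt0.
have [d d0 db] := small_mul e20 (proj1 Bb).
have [s As] := Acl d d0; have ls := bdd_lambda s.
have [d' d'0 d'l] := small_mul e20 (proj1 ls).
have [t Bt] := Bcl d' d'0.
exists (mul_comb s t); rewrite comp_sub_lambda_l.
by apply: bdd_le (bddD (bdd_comp As Bb) (bdd_comp ls Bt)); rewrite (mulrC _ d'); lra.
Qed.

Lemma normc_sum_le (I : Type) (r : seq (C * I)) (F : C * I -> C) (d : R) :
  (forall x, normc (F x) <= d) ->
  normc (\sum_(x <- r) x.1 * F x) <= d * \sum_(x <- r) normc x.1.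
Proof.
move=> Fd; apply: le_trans (normc_sum _ _ _) _; rewrite mulr_sumr.
by apply: ler_sum => x _; rewrite Normc.normcM mulrC ler_wpM2r ?normc_ge0.
Qed.

(** The approximant of [B] is chosen last, with a precision adapted to the sum of the coefficient
    norms of the approximant of [A]; this makes the coefficients of the product small. *)
Lemma coef_ideal_comp A B : cstar A -> coef_ideal B ->
  coef_ideal (A \o B) /\ coef_ideal (B \o A).
Proof.
move=> csA JB; have [csB _] := JB.
have [_ [b Bb] _] := (cstarP B).1 csB.
have [Alin [a Aa] Acl] := (cstarP A).1 csA.
have [Blin _ _] := (cstarP B).1 csB.
split; apply: coef_idealI; try exact: cstar_comp.
  move=> u v e e0; have e20 : 0 < e / 2 by rewrite divr_gt0.
  have [d d0 db] := small_mul e20 (proj1 Bb).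
  have [s As] := Acl d d0; have ls := bdd_lambda s.
  have [d' d'0 d'l] := small_mul e20 (proj1 ls).
  have [t [Bt ct]] := coef_ideal_approx JB d'0.
  exists (mul_comb s t).
    rewrite comp_sub_lambda_l.
    by apply: bdd_le (bddD (bdd_comp As Bb) (bdd_comp ls Bt)); rewrite (mulrC _ d'); lra.
  by rewrite coef_mull; apply: le_trans (normc_sum_le s (fun x => ct u _)) _; lra.
move=> u v e e0; have e20 : 0 < e / 2 by rewrite divr_gt0.
have [d d0 db] := small_mul e20 (proj1 Bb).
have [t At] := Acl d d0; have lt := bdd_lambda t.
have [d' d'0 d'l] := small_mul e20 (proj1 lt).
have [s [Bs cs]] := coef_ideal_approx JB d'0.
exists (mul_comb s t).
  rewrite comp_sub_lambda_r//.
  by apply: bdd_le (bddD (bdd_comp Bb At) (bdd_comp Bs lt)); rewrite (mulrC b); lra.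
by rewrite coef_mulr; apply: le_trans (normc_sum_le t (fun y => cs _ v)) _; lra.
Qed.

Lemma coef_ideal_comb (k : C) A B : coef_ideal A -> coef_ideal B ->
  coef_ideal (k *: A + B).
Proof.
move=> JA JB; have [csA _] := JA; have [csB _] := JB.
apply: coef_idealI; first exact: cstar_comb.
move=> u v e e0; have e20 : 0 < e / 2 by rewrite divr_gt0.
have k1 : 0 <= normc k + 1 by rewrite addr_ge0 ?normc_ge0.
have [d d0 dk] := small_mul e20 k1; rewrite mulrDr mulr1 in dk.
have kd0 : 0 <= d * normc k by rewrite mulr_ge0 ?normc_ge0 ?ltW.
have [s [As cs]] := coef_ideal_approx JA d0.
have [t [Bt ct]] := coef_ideal_approx JB d0.
exists (scale_comb k s ++ t).
  rewrite lambda_cat lambda_scale opprD addrACA -scalerBr.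
  by apply: bdd_le (bddD (bddZ k As) Bt); rewrite mulrC; lra.
rewrite coef_cat coef_scale; apply: le_trans (le_normcD _ _) _.
rewrite Normc.normcM; have := ct u v.
have : normc k * normc (coef u v s) <= normc k * (2 * d).
  by rewrite ler_wpM2l ?normc_ge0.
by rewrite (_ : normc k * (2 * d) = 2 * (d * normc k)); [lra|ring].
Qed.

Lemma coef_ideal_closed : closed_ideal coef_ideal.
Proof.
split.
- by move=> A [].
- split; last exact: coef_ideal_comb.
  apply: coef_idealI; first by have := cstar_lambda [::]; rewrite /lambda big_nil.
  move=> u v e e0; exists [::].
    by rewrite /lambda big_nil subrr; apply: bdd_le (ltW e0) (bdd0 _ _).
  by rewrite /coef big_nil Normc.normc0 ltW.
- by move=> A B csA JB; apply: coef_ideal_comp.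
move=> A [/bounded_operatorP[Alin Abdd] Acl].
have approx e : 0 < e -> exists s, bdd (A - lambda s) e /\
    forall u v, normc (coef u v s) <= e.
  move=> e0; have e20 : 0 < e / 2 by rewrite divr_gt0.
  have [B JB /ltW AB] := Acl _ e20.
  have [/cstarP[Blin _ _] _] := JB.
  have [t [Bt ct]] := coef_ideal_approx JB e20.
  exists t; split=> [|u v]; last by have := ct u v; lra.
  rewrite (_ : A - _ = (A - B) + (B - lambda t)); last by rewrite addrA subrK.
  apply: bdd_le (bddD (bdd_opnorm _ AB) Bt); first lra.
  exact: linearB.
apply: coef_idealI; last by move=> u v e /approx[s [As cs]]; exists s.
by apply/cstarP; split=> // e /approx[s [As _]]; exists s.
Qed.

(** The operator [lambda w] lies in the kernel, which is therefore non-zero, while the identity does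
    not. *)
Lemma not_Cstar_simple w : (forall u v, coef u v w = 0) -> lambda w != 0 ->
  ~ Cstar_simple R gT.
Proof.
move=> w0 lw /(_ coef_ideal coef_ideal_closed)[J0|Jall].
  have : coef_ideal (lambda w).
    apply: coef_idealI => [|u v e e0]; first exact: cstar_lambda.
    exists w; last by rewrite w0 Normc.normc0 ltW.
    by rewrite subrr; apply: bdd_le (ltW e0) (bdd0 _ _).
  by rewrite J0 => /= l0; rewrite l0 eqxx in lw.
(* The identity is its own approximant with error 0, but its coefficient at the trivial coset is
   1. *)
have [_ /(_ 1%g 1%g [:: (1, 1%g)] 0)] : coef_ideal (lambda [:: (1, 1%g)]).
  by rewrite Jall; apply: cstar_lambda.
rewrite subrr => /(_ (bdd0 _ _)).
rewrite /coef big_cons big_nil /= !mulg1 invg1 gpred1 addr0 Normc.normc1; lra.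
Qed.

End QuasiRegular.

(** * Half-trees and ends *)

Section HalfTrees.
Variable T : tree.
Implicit Types (x y z u v w a b : T) (p q : seq T) (g h : aut T).

Definition halftree x y : set T :=
  [set z | exists2 p, path (delete_edge x y) x p & last x p = z].

Lemma half_refl x y : halftree x y x.
Proof. by exists [::]. Qed.

(** A step along another edge prolongs the path; the deleted edge, taken from [y], arrives at [x],
    which is in the half-tree anyway. *)
Lemma halfS x y u v : halftree x y u -> adj u v -> halftree x y v \/ (u = x /\ v = y).
Proof.
move=> [p xp pu] uv.
have [|uvD] := boolP ((u, v) \in [:: (x, y); (y, x)]).
  rewrite !inE => /orP[/eqP[-> ->]|/eqP[_ ->]]; first by right.
  by left; apply: half_refl.
left; exists (rcons p v); last by rewrite last_rcons.
by rewrite rcons_path xp pu /delete_edge /= uv uvD.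
Qed.

Lemma half_path x y u p : halftree x y u -> path adj u p -> y \notin p ->
  forall z, z \in p -> halftree x y z.
Proof.
elim: p u => [//|v p IH] u xyu /= /andP[uv vp]; rewrite inE negb_or => /andP[yv yp].
have xyv : halftree x y v.
  by have [//|[_ vy]] := halfS xyu uv; rewrite vy eqxx in yv.
by move=> z; rewrite inE => /predU1P[->//|]; apply: IH vp yp z.
Qed.

Lemma half_last x y u p : halftree x y u -> path adj u p -> y \notin p ->
  halftree x y (last u p).
Proof.
move=> xyu up yp; have := mem_last u p; rewrite inE => /predU1P[->//|].
exact: half_path up yp _.
Qed.

(** A simple path from [x] to [y] avoiding their edge, closed up by that edge, would be a cycle with
    at least three vertices. *)
Lemma halfN x y : adj x y -> ~ halftree x y y.
Proof.
move=> xy [p xp py]; move: py; case/shortenP: xp => q xq + _ qy.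
have xadj : path adj x q by apply: sub_path xq => u v /andP[].
case: q xq xadj qy => [_ _ /= xy'|a [|b q]] /=.
- by rewrite xy' adj_irr in xy.
- by move=> /andP[/andP[_ +] _] _ ay; rewrite ay !inE eqxx.
move=> _ xadj qy quniq.
have /tree_acyclic// : ucycle adj [:: x, a, b & q].
apply/andP; split; last exact: quniq.
by rewrite (cycle_path x) /= qy adj_sym xy; exact: xadj.
Qed.

Lemma half_disj x y z : adj x y -> halftree x y z -> halftree y x z -> False.
Proof.
move=> xy xyz [p yp pz]; apply: (halfN xy); case: xyz => q xq qz.
exists (q ++ rev (belast y p)); last first.
  by rewrite last_cat qz; case: p yp pz => //= a p _ _; rewrite rev_cons last_rcons.
rewrite cat_path xq qz -pz rev_path; apply: sub_path yp => u v /=.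
by rewrite /delete_edge /= adj_sym !inE !xpair_eqE ![(u == _) && _]andbC.
Qed.

Lemma half_total x y z : adj x y -> halftree x y z \/ halftree y x z.
Proof.
move=> xy; have [p xp <-] := tree_connected x z.
suff walk u : path adj u p -> halftree x y u \/ halftree y x u ->
    halftree x y (last u p) \/ halftree y x (last u p).
  by apply: walk => //; left; apply: half_refl.
elim: p u {xp} => [//|v p IH] u /= /andP[uv vp] uh; apply: IH vp _.
case: uh => uh.
  by have [|[_ ->]] := halfS uh uv; [left | right; apply: half_refl].
by have [|[_ ->]] := halfS uh uv; [right | left; apply: half_refl].
Qed.

Lemma halfC x y : adj x y -> ~` halftree x y = halftree y x.
Proof.
move=> xy; apply/seteqP; split=> z /=; first by have [|] := half_total z xy.
by move=> yxz xyz; apply: half_disj xyz yxz.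
Qed.

Lemma half_cross x y u p : adj x y -> path adj u p -> halftree x y u ->
  halftree y x (last u p) -> x \in u :: p /\ y \in p.
Proof.
move=> xy + xyu; elim: p u xyu => [|v p IH] u xyu /=.
  by move=> _ yxu; case: (half_disj xy xyu yxu).
move=> /andP[uv vp] yxl; have [xyv|[ux vy]] := halfS xyu uv.
  by have [xvp yp] := IH _ xyv vp yxl; rewrite !(inE, yp) -in_cons xvp !orbT.
by rewrite !inE ux vy !eqxx.
Qed.

(** A path that leaves the half-tree and comes back crosses the edge in both directions, so it
    visits [x] twice. *)
Lemma half_convex x y u p : adj x y -> path adj u p -> uniq (u :: p) ->
  halftree x y u -> halftree x y (last u p) -> forall z, z \in p -> halftree x y z.
Proof.
move=> xy up upu xyu xyl z zp; have [//|yxz] := half_total z xy.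
case/path.splitP: zp up upu xyl => p1 p2.
rewrite cat_path last_cat last_rcons -cat_cons cat_uniq.
move=> /andP[up1 zp2] /and3P[_ /hasPn p12 _] xyl.
have [xp1 _] : x \in u :: rcons p1 z /\ y \in rcons p1 z.
  by apply: half_cross; rewrite ?last_rcons.
have [_ xp2] : y \in z :: p2 /\ x \in p2 by apply: half_cross; rewrite 1?adj_sym.
by have := p12 x xp2; rewrite xp1.
Qed.

Lemma simple_path u v : exists p, [/\ path adj u p, uniq (u :: p) & last u p = v].
Proof.
have [p up uv] := tree_connected u v.
by move: uv; case/shortenP: up => q uq quniq _ qv; exists q.
Qed.

(** By convexity the simple path from [u] to [z] stays in the first half-tree, so it avoids [b] and
    cannot leave the second. *)
Lemma half_sub x y a b u : adj x y -> halftree x y u -> halftree a b u ->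
  ~ halftree x y b ->
  halftree x y `<=` halftree a b.
Proof.
move=> xy xyu abu xyb z xyz; have [p [up upu pz]] := simple_path u z.
rewrite -pz in xyz *.
apply: (half_last abu up); apply/negP => bp; apply: xyb.
exact: half_convex xy up upu xyu xyz _ bp.
Qed.

Lemma toward_ex x z : x <> z -> exists2 y, adj x y & halftree y x z.
Proof.
move=> xz; have [[|y p] [//= /andP[xy yp] xyp pz]] := simple_path x z.
exists y => //; rewrite -pz; apply: half_last => //; first exact: half_refl.
by move: xyp; rewrite inE negb_or; case/and3P => /andP[].
Qed.

Lemma half_sibling x y y' : adj x y -> adj x y' -> y <> y' ->
  halftree y' x `<=` halftree x y.
Proof.
move=> xy xy' yy'; have y'x : adj y' x by rewrite adj_sym.
apply: (@half_sub _ _ _ _ y') => //; first exact: half_refl.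
  have [//|[_ y'y]] := halfS (half_refl x y) xy'.
  by case: yy'.
move=> y'xy; have yx : adj y x by rewrite adj_sym.
have [|[]//] := halfS y'xy yx; exact: halfN.
Qed.

Lemma toward_uniq x y y' z : adj x y -> adj x y' -> halftree y x z -> halftree y' x z ->
  y = y'.
Proof.
move=> xy xy' yz y'z; apply: contrapT => yy'.
by apply: (half_disj xy _ yz); apply: half_sibling y'z.
Qed.

Lemma half_toward x a b : adj a b -> ~ halftree a b x ->
  exists2 y, adj x y & halftree a b `<=` halftree y x.
Proof.
move=> ab abx; have xa : x <> a by move=> xa; apply: abx; rewrite xa; exact: half_refl.
have [y xy ya] := toward_ex xa; exists y => //.
by apply: (half_sub ab _ ya) => //; exact: half_refl.
Qed.

(** The first step must go to the unique neighbour of [u] on the side of the endpoint; then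
    induct. *)
Lemma simple_path_uniq u p q : path adj u p -> uniq (u :: p) ->
  path adj u q -> uniq (u :: q) -> last u p = last u q -> p = q.
Proof.
elim: p u q => [|a p IH] u [|b q] //=.
- by move=> _ _ _ /andP[/negP ubq _] ul; case: ubq; rewrite {1}ul mem_last.
- by move=> _ /andP[/negP uap _] _ _ ul; case: uap; rewrite -{1}ul mem_last.
move=> /andP[ua ap] /andP[uap puniq] /andP[ub bq] /andP[ubq quniq] pq.
have notin c r : u \notin c :: r -> u \notin r by rewrite inE negb_or => /andP[].
have ab : a = b.
  apply: (@toward_uniq u _ _ (last a p)) => //; last rewrite pq.
    by apply: half_last => //; [exact: half_refl | exact: notin uap].
  by apply: half_last => //; [exact: half_refl | exact: notin ubq].
by rewrite -ab in bq quniq pq *; congr (_ :: _); apply: (IH a).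
Qed.

Lemma aut_adj g x y : adj (g x) (g y) = adj x y.
Proof. by have /asboolP[_ ->] := valP g. Qed.

Lemma aut_inj g : injective g.
Proof. by have /asboolP[/bij_inj] := valP g. Qed.

Lemma autM g h x : ((g * h)%g : aut T) x = g (h x).
Proof. by []. Qed.

Lemma autK g x : (g^-1%g : aut T) (g x) = x.
Proof. by rewrite -autM mulVg. Qed.

Lemma autVK g x : g ((g^-1%g : aut T) x) = x.
Proof. by rewrite -autM mulgV. Qed.

Lemma aut_eq g h : g =1 h -> g = h.
Proof. by move=> gh; apply: val_inj; apply/funext. Qed.

Lemma half_aut g x y z : halftree x y z -> halftree (g x) (g y) (g z).
Proof.
move=> [p xp <-]; exists (map g p); last by rewrite last_map.
rewrite path_map; apply: sub_path xp => u v /=.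
by rewrite /delete_edge /= aut_adj !inE !xpair_eqE !(inj_eq (@aut_inj g)).
Qed.

Lemma half_autE g x y z : halftree (g x) (g y) z <-> halftree x y ((g^-1%g : aut T) z).
Proof.
by split=> [/(half_aut g^-1%g)|/(half_aut g)]; rewrite ?autK ?autVK.
Qed.

End HalfTrees.

(** * Ends and rays *)

Section Ends.
Variable T : tree.
Implicit Types (x y z : T) (r s : nat -> T) (g : aut T).

Lemma cofinal_sym r s : cofinal r s -> cofinal s r.
Proof. by move=> [m [n rs]]; exists n, m => k; rewrite rs. Qed.

Lemma cofinal_trans r s t : cofinal r s -> cofinal s t -> cofinal r t.
Proof.
move=> [m [n rs]] [m' [n' st]]; exists (m + m')%N, (n + n')%N => k.
by rewrite -addnA rs addnCA st addnCA addnA.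
Qed.

Lemma cofinal_comp g r s : cofinal r s -> cofinal (g \o r) (g \o s).
Proof. by move=> [m [n rs]]; exists m, n => k /=; rewrite rs. Qed.

Lemma ray_comp g r : ray r -> ray (g \o r).
Proof.
move=> [radj rinj]; split=> [n|]; first by rewrite /= aut_adj.
by move=> m n /aut_inj/rinj.
Qed.

Lemma fixes_end_cofinal g r : cofinal (g \o r) r ->
  fixes_end g [set s | ray s /\ cofinal r s].
Proof.
move=> gr; apply/seteqP; split=> [_ [s [rays rs] <-]|s [rays rs]] /=.
  split; first exact: ray_comp.
  by apply: cofinal_trans (cofinal_sym gr) _; apply: cofinal_comp.
pose gV : aut T := g^-1%g.
exists (gV \o s); last by apply/funext => n /=; exact: autVK.
split; first exact: ray_comp.
have := cofinal_comp gV gr; have -> : gV \o (g \o r) = r.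
  by apply/funext => n; exact: autK.
by move/cofinal_trans; apply; apply: cofinal_comp.
Qed.

(** A ray visits [x] at most once; from then on it can no longer cross the edge. *)
Lemma ray_half r x y : ray r -> adj x y ->
  (exists N, forall n, halftree x y (r (N + n)%N)) \/
  (exists N, forall n, halftree y x (r (N + n)%N)).
Proof.
move=> [radj rinj] xy.
have [N rN] : exists N, forall n, r (N + n)%N <> x.
  have [[k rk]|norx] := pselect (exists k, r k = x).
    by exists k.+1 => n; rewrite -rk => /rinj; lia.
  by exists 0%N => n rn; apply: norx; exists n.
have [h0|h0] := half_total (r N) xy; [left|right]; exists N.
all: elim=> [|n IH]; rewrite ?addn0// addnS.
- by have [//|[/(rN n)]] := halfS IH (radj (N + n)%N).
- have [//|[_ rx]] := halfS IH (radj (N + n)%N).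
  by case: (rN n.+1); rewrite addnS.
Qed.

End Ends.

(** * Normal subgroups *)

Section SmallHalfTrees.
Variables (T : tree) (G : groupClosed (aut T)) (N : set (aut T)).
Hypothesis G_minimal : minimal_action G.
Hypothesis no_fixed_end : forall xi, ends xi ->
  exists2 g : aut T, g \in G & ~ fixes_end g xi.
Hypothesis N_normal : forall n g, N n -> g \in G -> N (g * n * g^-1)%g.
Implicit Types (x y z a b : T) (g n : aut T).

Definition small x y :=
  exists2 n, N n & forall z, halftree x y z -> ~ halftree x y (n z).

Let small_sub x y a b : halftree a b `<=` halftree x y -> small x y -> small a b.
Proof. by move=> sub [n Nn nxy]; exists n => // z /sub/nxy + /sub. Qed.

Let small_aut g x y : g \in G -> small x y -> small (g x) (g y).
Proof.
move=> gG [n Nn nxy]; exists (g * n * g^-1)%g; first exact: N_normal.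
move=> z /half_autE/nxy zxy; rewrite !autM => /half_autE.
by rewrite autK.
Qed.

Let big_aut g x y : g \in G -> ~ small x y -> ~ small (g x) (g y).
Proof.
move=> gG xy gxy; apply: xy; rewrite -(autK g x) -(autK g y).
by apply: small_aut; rewrite ?gpredV.
Qed.

(* An intersection of half-trees is a subtree, so it is empty by minimality. *)
Let invariant_family (F : T -> T -> Prop) a b : adj a b -> F a b ->
  (forall x y, F x y -> adj x y) ->
  (forall g x y, g \in G -> F x y -> F (g x) (g y)) ->
  forall z, exists x y, F x y /\ ~ halftree x y z.
Proof.
move=> ab Fab Fadj Faut z.
pose W := [set z | forall x y, F x y -> halftree x y z].
apply: contrapT => zW.
have WT : W = setT.
  apply: G_minimal.
  - exists z => x y Fxy; apply: contrapT => xyz; apply: zW; by exists x, y.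
  - move=> u v Wu Wv; have [p [up upu pv]] := simple_path u v.
    exists p => //; split=> // w wp x y Fxy.
    apply: half_convex (Fadj _ _ Fxy) up upu (Wu _ _ Fxy) _ _ wp.
    by rewrite pv; apply: (Wv _ _ Fxy).
  - move=> g w gG Ww x y Fxy; rewrite -(autVK g x) -(autVK g y).
    by apply/half_aut/Ww/Faut; rewrite ?gpredV.
have : W b by rewrite WT.
by move/(_ a b Fab); apply: halfN.
Qed.

(** Complements of small half-trees form an invariant family, so [x] lies in a small half-tree, the
    one of [b] against [a]. It contains one of the two sides of the edge [x], [y]. *)
Let nonsmall_compl a0 b0 : adj a0 b0 -> small a0 b0 ->
  forall x y, adj x y -> ~ small x y -> small y x.
Proof.
move=> ab0 small0 x y xy nxy; have yx : adj y x by rewrite adj_sym.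
have [|||//|a [b [[ab sba] abx]]] := @invariant_family
  (fun a b => adj a b /\ small b a) b0 a0 _ _ _ _ x.
- by rewrite adj_sym.
- by rewrite adj_sym.
- by move=> u v [].
- by move=> g u v gG [uv svu]; rewrite aut_adj; split=> //; apply: small_aut.
have bax : halftree b a x by have [] := half_total x ab.
have ba : adj b a by rewrite adj_sym.
(* If [a] is outside the side of [x], that side lies in the small half-tree, which is excluded;
   otherwise the side of [y] does. *)
have [xya|xya] := pselect (halftree x y a); last first.
  by case: nxy; apply: small_sub sba; apply: half_sub xy (half_refl x y) bax xya.
have bay : halftree b a y.
  by have [//|[_ ya]] := halfS bax xy; case: (halfN xy); rewrite {2}ya.
apply: small_sub sba; apply: half_sub yx (half_refl y x) bay _.
by move=> yxa; apply: half_disj xy xya yxa.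
Qed.

(** Otherwise each vertex [z] has exactly one neighbour [s z] beyond which the half-tree is not
    small. Iterating [s] gives a ray whose end does not depend on the starting vertex, so [G] fixes
    it. *)
Lemma all_small a0 b0 : adj a0 b0 -> small a0 b0 ->
  forall x y, adj x y -> small x y.
Proof.
move=> ab0 small0 x0 y0 xy0; apply: contrapT => nsmall0.
have compl := nonsmall_compl ab0 small0.
pose F x y := adj x y /\ ~ small x y.
(* If disjoint, one would lie in the complement of the other, which is small by [compl]. *)
have meet x y a b : F x y -> F a b -> exists2 z, halftree x y z & halftree a b z.
  move=> [xy nxy] [ab nab]; apply: contrapT => disj; apply: nxy.
  apply: small_sub (compl _ _ ab nab); rewrite -(halfC ab) => z xyz abz.
  by apply: disj; exists z.
have Faut g x y : g \in G -> F x y -> F (g x) (g y).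
  by move=> gG [xy nxy]; split; [rewrite aut_adj | apply: big_aut].
have Fnext z : exists y, F y z.
  have [//|x [y [[xy nxy] xyz]]] := @invariant_family F x0 y0 xy0 (conj xy0 nsmall0) _ Faut z.
    by move=> u v [].
  have [s zs sub] := half_toward xy xyz; exists s; split; first by rewrite adj_sym.
  by move=> /(small_sub sub).
have Funiq z y y' : F y z -> F y' z -> y = y'.
  move=> Fy Fy'; have [w] := meet _ _ _ _ Fy Fy'.
  by apply: toward_uniq; rewrite adj_sym; [case: Fy | case: Fy'].
have [s Fs] := choice Fnext.
have adjs z : adj z (s z) by rewrite adj_sym; case: (Fs z).
have s_aut g z : g \in G -> s (g z) = g (s z).
  by move=> gG; apply: Funiq (Fs _) _; apply: Faut.
have ss z : s (s z) <> z.
  move=> ssz; have [w] := meet _ _ _ _ (Fs z) (Fs (s z)); rewrite ssz => szw zsw.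
  exact: half_disj (adjs z) zsw szw.
(* Otherwise the half-trees chosen at [x] and [y] would lie on opposite sides of their edge,
   although they meet. *)
have merge1 x y : adj x y -> s x = y \/ s y = x.
  move=> xy; have yx : adj y x by rewrite adj_sym.
  have [->|sxy] := pselect (s x = y); [by left|right; apply: contrapT => syx].
  have [w xw yw] := meet _ _ _ _ (Fs x) (Fs y).
  apply: (half_disj xy (z := w)).
    by apply: half_sibling xw => // ysx; apply: sxy.
  by apply: half_sibling yw => // xsy; apply: syx.
have merge x y : exists m k : nat, iter m s x = iter k s y.
  have [p + <-] := tree_connected x y.
  elim: p x => [|v p IH] x /=; first by exists 0%N, 0%N.
  move=> /andP[xv /IH[m [k mk]]]; have [sx|sv] := merge1 _ _ xv.
    by exists m.+1, k; rewrite iterSr sx.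
  by exists m, k.+1; rewrite -sv -iterSr !iterS mk.
pose r k := iter k s x0.
(* As [s] never turns back, the half-trees ahead of the iterates are nested, and hence the iterates
   are distinct. *)
have rS m k : halftree (r (m + k).+1) (r (m + k)%N) `<=` halftree (r m.+1) (r m).
  elim: k => [|k IH]; first by rewrite addn0.
  apply: subset_trans IH; rewrite addnS.
  apply: half_sibling; rewrite ?adjs// 1?adj_sym ?adjs//=.
  by move=> e; apply: (ss (r (m + k)%N)).
have rinj m k : (m < k)%N -> r m <> r k.
  move=> mk rmk; have := rS m (k - m.+1)%N (r (m + (k - m.+1)).+1)%N (half_refl _ _).
  by rewrite -addSn subnKC// -rmk; apply: halfN; rewrite adj_sym.
have ray_r : ray r.
  split=> [k|m k rmk]; first exact: adjs.
  by have [/rinj/(_ rmk)|/rinj/(_ (esym rmk))|//] := ltngtP m k.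
have [|g gG] := @no_fixed_end [set t | ray t /\ cofinal r t]; first by exists r.
apply; apply: fixes_end_cofinal.
(* Since [s] commutes with [g], the image of the ray is the orbit of [g x0] under [s], which merges
   with that of [x0]. *)
have [m [k mk]] := merge (g x0) x0.
have giter j : iter j s (g x0) = g (iter j s x0).
  by elim: j => //= j ->; rewrite s_aut.
exists m, k => j /=; rewrite -giter !(addnC _ j) /r [RHS]iterD -mk.
by rewrite iterD.
Qed.

End SmallHalfTrees.

(** * Branching vertices and invariant means on the tree *)

Section Branching.
Variables (T : tree) (G : groupClosed (aut T)).
Hypothesis G_minimal : minimal_action G.
Implicit Types (x y z a b : T) (g n : aut T).

Definition branching x :=
  exists a b c, [/\ adj x a, adj x b, adj x c & [/\ a <> b, b <> c & a <> c]].

Lemma branching_aut g x : branching x -> branching (g x).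
Proof.
move=> [a [b [c [xa xb xc [ab bc ac]]]]]; exists (g a), (g b), (g c).
by split; rewrite ?aut_adj//; split=> /aut_inj.
Qed.

(** The vertices fixed by every automorphism that fixes all branching vertices form a non-empty
    [G]-invariant subtree; minimality applies. *)
Lemma fix_branching v n : branching v -> (forall x, branching x -> n x = x) -> n = 1%g.
Proof.
move=> bv nfix.
pose W := [set x | forall g, (forall y, branching y -> g y = y) -> g x = x].
suff WT : W = setT by apply: aut_eq => x; have : W x by [rewrite WT]; exact.
apply: G_minimal.
- by exists v => g gfix; apply: gfix.
- move=> u w Wu Ww; have [p [up upu pw]] := simple_path u w.
  exists p => //; split=> // z zp g gfix.
  have gu := Wu g gfix; have gw := Ww g gfix.
  have gp : map g p = p.
    apply: (@simple_path_uniq _ u) => //.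
    + by rewrite -[X in path _ X]gu path_map; apply: sub_path up => a b; rewrite /= aut_adj.
    + by rewrite -[X in X :: _]gu -[_ :: _]/(map g (u :: p)) (map_inj_uniq (@aut_inj _ g)).
    + by rewrite -[X in last X _]gu last_map pw.
  by have /nthP - /(_ u)[i ip <-] := zp; rewrite -{2}gp (nth_map u).
- move=> g x gG Wx h hfix.
  rewrite -{2}(Wx (g^-1 * h * g)%g) ?autM ?autVK// => y by_.
  by rewrite !autM hfix ?autK//; apply: branching_aut.
Qed.

Lemma small_of_branching v n : branching v -> n v <> v ->
  exists a, adj a v /\ forall z, halftree a v z -> ~ halftree a v (n z).
Proof.
move=> [a [b [c [va vb vc [ab bc ac]]]]] nv.
have [x vx xnv] := toward_ex (not_eq_sym nv).
have [y ny yv] := toward_ex nv.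
(* Each of the two conditions excludes at most one of the three neighbours. They make the half-tree
   beyond [w] disjoint from its image under [n]. *)
have [w vw [wx nwy]] : exists2 w, adj v w & w <> x /\ n w <> y.
  have ninj := @aut_inj _ n.
  have [ax|ax] := pselect (a = x).
    have [nby|nby] := pselect (n b = y).
      by exists c => //; split=> [cx|ncy]; [apply: ac; rewrite ax
        | apply: bc; apply: ninj; rewrite nby].
    by exists b => //; split=> // bx; apply: ab; rewrite ax.
  have [nay|nay] := pselect (n a = y); last by exists a.
  have [bx|bx] := pselect (b = x).
    by exists c => //; split=> [cx|ncy]; [apply: bc; rewrite bx
        | apply: ac; apply: ninj; rewrite nay].
  by exists b => //; split=> // nby; apply: ab; apply: ninj; rewrite nay.
exists w; split; first by rewrite adj_sym.
move=> z wz nwz; have wv : adj w v by rewrite adj_sym.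
have wnv : ~ halftree w v (n v).
  by move=> wnv; apply: wx; apply: toward_uniq vw vx wnv xnv.
have sub := half_sub wv nwz (half_aut n wz) wnv.
have [nwv|[_ /esym//]] := halfS (sub w (half_refl w v)) wv.
by apply: nwy; apply: toward_uniq nwv yv => //; rewrite aut_adj.
Qed.

(** Without branching, a pointwise fixed edge propagates: if [g] moved a further neighbour [v] of
    [u], then [w], [v] and [g v] would be three neighbours of [u]. So [g] would be trivial. *)
Lemma branching_ex x y g : adj x y -> (forall z, halftree x y z -> g z = z) ->
  g != 1%g -> exists v, branching v.
Proof.
move=> xy gfix; apply: contraNP => nobr; apply/eqP/aut_eq.
pose fixed_edge u w := [/\ adj u w, g u = u & g w = w].
have step u w v : fixed_edge u w -> adj u v -> fixed_edge v u.
  move=> [uw gu gw] uv; split=> //; first by rewrite adj_sym.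
  apply: contrapT => gv; apply: nobr; exists u, w, v, (g v).
  have wv : w <> v by move=> wv; rewrite wv in gw.
  split=> //; first by rewrite -{1}gu aut_adj.
  by split; [|exact: not_eq_sym|rewrite -{1}gw => /aut_inj].
have gx : g x = x by apply/gfix/half_refl.
(* A neighbour of [x] other than [y] is in the fixed half-tree; if there is none, [g] must preserve
   [y]. *)
have [w xw] : exists w, fixed_edge x w.
  have [[w xw wy]|onlyy] := pselect (exists2 w, adj x w & w <> y).
    exists w; split=> //; apply: gfix.
    by have [//|[]] := halfS (half_refl x y) xw.
  exists y; split=> //; apply: contrapT => gy; apply: onlyy.
  by exists (g y) => //; rewrite -{1}gx aut_adj.
move=> z; have [p + <-] := tree_connected x z.
elim: p x w xw {xy gfix gx} => [x w []//|v p IH] x w xw /= /andP[xv].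
by apply: IH; apply: step xw xv.
Qed.

(** Two complementary small half-trees have mass exactly 1/2 each, so the three disjoint ones around
    [v] would have total mass 3/2. *)
Lemma no_invariant_mean (R : realType) (m : set T -> R) (N : set (aut T)) v :
  (forall A, 0 <= m A) -> m setT = 1 ->
  (forall A B, A `&` B = set0 -> m (A `|` B) = m A + m B) ->
  (forall n A, N n -> m [set n x | x in A] = m A) ->
  branching v -> ~ (forall x y, adj x y -> small N x y).
Proof.
move=> m_ge0 mT mU mN [a [b [c [va vb vc [ab bc ac]]]]] allsmall.
have half_le x y : adj x y -> 2 * m (halftree x y) <= 1.
  move=> xy; have [n Nn nxy] := allsmall x y xy.
  have := mean_le1 m_ge0 mT mU (halftree x y `|` [set n z | z in halftree x y]).
  rewrite mU ?mN//; first by lra.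
  by apply/seteqP; split=> // t [+ [z xyz zt]]; rewrite -zt; exact: nxy.
have half_ge x y : adj x y -> 1 <= 2 * m (halftree x y).
  move=> xy; have := half_le y x; rewrite adj_sym => /(_ xy).
  have := mU _ _ (setICr (halftree x y)); rewrite setUCr mT halfC//; lra.
have disj y y' : adj v y -> adj v y' -> y <> y' ->
    halftree y v `&` halftree y' v = set0.
  move=> vy vy' yy'; apply/seteqP; split=> // z [yz y'z]; apply: yy'.
  exact: toward_uniq yz y'z.
have := mean_le1 m_ge0 mT mU (halftree a v `|` (halftree b v `|` halftree c v)).
rewrite mU; last by rewrite setIUr !disj// setU0.
rewrite mU ?disj//.
move: (half_ge a v) (half_ge b v) (half_ge c v); rewrite !(adj_sym _ v).
by move=> /(_ va) + /(_ vb) + /(_ vc); lra.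
Qed.

End Branching.

Lemma amenable_normal_trivial (R : realType) (T : tree) (G : groupClosed (aut T)) :
  minimal_action G ->
  (forall xi, ends xi -> exists2 g : aut T, g \in G & ~ fixes_end g xi) ->
  (exists v : T, branching v) ->
  forall M : groupClosed (subgrp G), normal_subgroup M -> amenable R (subgrp M) ->
  forall n, n \in M -> n = 1%g.
Proof.
move=> Gmin Gend [v bv] M Mnormal [mu [mu_ge0 muT muU mul_mu]] n nM.
pose N : set (aut T) := [set val k | k in [set k : subgrp G | k \in M]].
apply: contrapT => n1.
have [w [bw nw]] : exists w : T, branching w /\ (val n : aut T) w <> w.
  apply: contrapT => nofix; apply: n1; apply: val_inj => /=.
  apply: (fix_branching Gmin bv) => x bx; apply: contrapT => nx; apply: nofix.
  by exists x.
have [a [aw small_a]] := small_of_branching bw nw.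
have Nnormal k g : N k -> g \in G -> N (g * k * g^-1)%g.
  move=> [h hM <-] gG; have gVG : (g^-1)%g \in G by rewrite gpredV.
  pose gV : subgrp G := Sub (g^-1)%g gVG.
  exists (h ^ gV)%g; first exact: Mnormal.
  by rewrite conjgE /= invgK mulgA.
have allsmall (x y : T) : adj x y -> small N x y.
  have Nn : N (val n) by exists n.
  have sm : small N a w by exists (val n).
  have st := all_small Gmin Gend Nnormal.
  exact: (st _ _ aw sm).
(* The mean of the subgroup is pushed forward along the orbit map of [v]. *)
pose m (A : set T) := mu [set k : subgrp M | A ((val (val k) : aut T) v)].
apply: (@no_invariant_mean _ _ m N v _ _ _ _ bv allsmall).
- by move=> A; apply: mu_ge0.
- by rewrite /m -[RHS]muT; congr mu; apply/seteqP.
- move=> A B AB; rewrite /m -muU; first by congr mu.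
  apply/seteqP; split=> // k [/= Ak Bk].
  by have : (A `&` B) ((val (val k) : aut T) v) by []; rewrite AB.
- move=> _ A [k kM <-]; rewrite /m -[RHS](mul_mu (Sub k kM)); congr mu.
  apply/seteqP; split=> [h /= [x Ax xh]|_ /= [h Ah <-]].
    exists ((Sub k kM : subgrp M)^-1 * h)%g; last by rewrite mulVKg.
    by rewrite /= autM -xh autK.
  by exists ((val (val h) : aut T) v).
Qed.

(** * Stabilizers of ends *)

(** Transport of [amenable_doubling] along an isomorphism from [K] onto [H]. *)
Lemma doubling_image (R : realType) (K gT : groupType) (H : groupClosed gT)
  (psi : K -> gT) : injective psi -> {morph psi : x y / (x * y)%g} ->
  (forall k, psi k \in H) -> (forall x, x \in H -> exists k, psi k = x) ->
  amenable R K ->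
  forall S : {fset gT}, {subset S <= H} ->
  exists F : {fset gT}, [/\ {subset F <= H}, F != fset0 &
    (#|` fset_mul S F| < 2 * #|` F|)%N].
Proof.
move=> psi_inj psiM psiH Hpsi amK S SH.
have /choice[f fH] x : exists k, x \in H -> psi k = x.
  by have [/Hpsi[k kx]|] := boolP (x \in H); [exists k | exists 1%g].
have [F F0 ltF] := amenable_doubling [fset f x | x in S]%fset amK.
exists [fset psi k | k in F]%fset; split.
- by move=> _ /imfsetP[k _ ->].
- have /fset0Pn[k kF] := F0; apply/fset0Pn; exists (psi k).
  by apply/imfsetP; exists k.
rewrite [X in (_ < 2 * X)%N]card_imfset//; apply: leq_ltn_trans ltF.
have <- : #|` [fset psi k | k in fset_mul [fset f x | x in S] F]%fset| =
    #|` fset_mul [fset f x | x in S]%fset F| by rewrite card_imfset.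
apply/fsubset_leq_card/fsubsetP => _ /imfset2P[x /= xS [_ /imfsetP[k /= kF ->] ->]].
apply/imfsetP; exists (f x * k)%g => /=.
  by apply/imfset2P; exists (f x); [apply/imfsetP; exists x | exists k].
by rewrite psiM fH// SH.
Qed.

Lemma amenable_trivial (R : realType) (gT : groupType) :
  (forall x : gT, x = 1%g) -> amenable R gT.
Proof.
move=> gT1; exists (fun A => (`[< A 1%g >])%:R); split=> [A||A B AB|g A].
- exact: ler0n.
- by rewrite asboolT.
- have [A1|A1] := pselect (A 1%g); last first.
    rewrite (asboolF A1) add0r; congr (_%:R); congr nat_of_bool.
    by apply/asbool_equiv_eq; split=> [[]|]; [|by []|right].
  have B1 : ~ B 1%g by move=> B1; have : (A `&` B) 1%g by []; rewrite AB.
  by rewrite (asboolF B1) (asboolT A1) asboolT ?addr0//; left.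
congr (_%:R); congr nat_of_bool; apply/asbool_equiv_eq; split=> [[x Ax _]|A1].
  by rewrite -(gT1 x).
by exists 1%g; rewrite // mulg1.
Qed.

Section StabInGroup.
Variables (T : tree) (G : groupClosed (aut T)) (xi : set (nat -> T)).

(** The stabilizer as a subgroup of the group [subgrp G], whose regular representation is studied;
    [stab_end] lives in [aut T]. *)
Definition stab_in : {pred subgrp G} := [pred x | val x \in stab_end G xi].

Fact stab_in_mul : mulg_closed stab_in.
Proof. by move=> x y; exact: (@stab_end_mul _ G xi (val x) (val y)). Qed.
Fact stab_in_one : 1%g \in stab_in.
Proof. exact: stab_end_one. Qed.
Fact stab_in_inv : invg_closed stab_in.
Proof. by move=> x; exact: (@stab_end_inv _ G xi (val x)). Qed.

HB.instance Definition _ := isMulClosed.Build (subgrp G) stab_in stab_in_mul.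
HB.instance Definition _ := isMul1Closed.Build (subgrp G) stab_in stab_in_one.
HB.instance Definition _ := isInvClosed.Build (subgrp G) stab_in stab_in_inv.

End StabInGroup.
Arguments stab_in {T} G xi.

Lemma stab_in_doubling (R : realType) (T : tree) (G : groupClosed (aut T)) xi :
  amenable R (subgrp (stab_end G xi)) ->
  forall S : {fset subgrp G}, {subset S <= stab_in G xi} ->
  exists F : {fset subgrp G}, [/\ {subset F <= stab_in G xi}, F != fset0 &
    (#|` fset_mul S F| < 2 * #|` F|)%N].
Proof.
have inG (k : subgrp (stab_end G xi)) : val k \in G by have /andP[] := valP k.
pose psi (k : subgrp (stab_end G xi)) : subgrp G := Sub (val k) (inG k).
apply: (doubling_image (H := stab_in G xi) (psi := psi)).
- by move=> k l /(congr1 val) /= /val_inj.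
- by move=> k l; apply: val_inj.
- by move=> k; rewrite inE /=; apply: valP.
- by move=> x; rewrite inE => xs; exists (Sub (val x) xs); apply: val_inj.
Qed.

(** Each automorphism preserves the half-tree that it need not fix: if [g z] lands in the fixed
    side, then [g (g z) = g z] and [z] was fixed already. *)
Lemma aut_commute (T : tree) (x y : T) (g h : aut T) : adj x y ->
  (forall z, halftree x y z -> g z = z) -> (forall z, halftree y x z -> h z = z) ->
  (g * h = h * g)%g.
Proof.
move=> xy gfix hfix; apply: aut_eq => z; rewrite !autM.
have [xyz|yxz] := half_total z xy.
  rewrite (gfix z xyz) gfix//; have [//|yxh] := half_total (h z) xy.
  by have := hfix _ yxh => /aut_inj => hz; rewrite hz.
rewrite (hfix z yxz) hfix//; have [xyg|//] := half_total (g z) xy.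
by have := gfix _ xyg => /aut_inj => gz; rewrite gz.
Qed.

Lemma conj_fixes_end (T : tree) (r : nat -> T) (A : set T) (g u : aut T) :
  (forall z, A z -> g z = z) -> (exists N, forall n, A (u (r (N + n)%N))) ->
  fixes_end (g ^ u)%g [set s | ray s /\ cofinal r s].
Proof.
move=> gfix [N AN]; apply: fixes_end_cofinal; exists N, N => n /=.
by rewrite conjgE !autM gfix// autK.
Qed.

Theorem theoremA (R : realType) (T : tree) (G : groupClosed (aut T))
  (G_countable : countable [set` G])
  (G_minimal : minimal_action G)
  (G_general : general_type G)
  (G_fixators : forall A : set T, half_tree A ->
     exists2 g : aut T, fixator G A g & g != 1%g)
  (G_stab : exists2 xi : set (nat -> T), ends xi &
     amenable R (subgrp (stab_end G xi))) :
  is_amenable_radical R (trivial_subgroup (subgrp G)) /\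
  ~ Cstar_simple R (subgrp G).
Proof.
have no_fixed_end xi : ends xi -> exists2 g : aut T, g \in G & ~ fixes_end g xi.
  have [g [h [gG hG _ _ gh]]] := G_general => /gh ghxi.
  have [gxi|] := pselect (fixes_end g xi); last by exists g.
  by exists h => // hxi; apply: ghxi.
have [xi [r rayr xiE] am_stab] := G_stab.
pose x := r 0%N; pose y := r 1%N.
have xy : adj x y by have [radj _] := rayr; apply: radj.
have yx : adj y x by rewrite adj_sym.
have [|g [gG gfix] g1] := G_fixators (halftree x y); first by exists x, y.
have [|h [hG hfix] h1] := G_fixators (halftree y x); first by exists y, x.
split.
  have branch := branching_ex xy gfix g1.
  split.
  - by move=> n k /(elimT eqP) ->; rewrite conj1g; apply: gpred1.
  - apply: amenable_trivial => n; apply: val_inj.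
    exact: (elimT eqP (valP n)).
  - move=> M Mnormal amM n nM; apply: (introT eqP).
    exact: (amenable_normal_trivial G_minimal no_fixed_end branch Mnormal amM).
pose g' : subgrp G := Sub g gG; pose h' : subgrp G := Sub h hG.
have g'1 : g' != 1%g by apply: contraNneq g1 => /(congr1 val) /= ->.
have h'1 : h' != 1%g by apply: contraNneq h1 => /(congr1 val) /= ->.
have gh : (g' * h' = h' * g')%g by apply: val_inj; apply: aut_commute xy gfix hfix.
(* The translate of the ray by [u] ends up on one side of the edge, where [g] or [h] acts
   trivially. *)
have stab u : (g' ^ u)%g \in stab_in G xi \/ (h' ^ u)%g \in stab_in G xi.
  have [Nx|Nx] := ray_half (ray_comp (val u) rayr) xy; [left|right]; rewrite inE.
    apply/andP; split; first exact: valP.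
    by apply/asboolP; rewrite -xiE; apply: conj_fixes_end gfix Nx.
  apply/andP; split; first exact: valP.
  by apply/asboolP; rewrite -xiE; apply: conj_fixes_end hfix Nx.
(* (1 - g)(1 - h) acts as zero on l2 of the orbit of xi: every end in this orbit
   is fixed by g or by h, and g and h commute. *)
pose w : seq (R[i] * subgrp G) :=
  [:: (1, 1%g); (-1, g'); (-1, h'); (1, (g' * h')%g)].
apply: (not_Cstar_simple (stab_in_doubling am_stab) (w := w)).
  move=> u v; rewrite /coef !big_cons big_nil /= mulg1.
  (* A right factor [k] fixing the coset of [u] does not change the coefficient, so the four terms
     of [w] cancel in pairs. *)
  have mem k l : (k ^ u)%g \in stab_in G xi ->
      ((v^-1 * (l * k) * u)%g \in stab_in G xi) = ((v^-1 * l * u)%g \in stab_in G xi).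
    move=> ku; have -> : (v^-1 * (l * k) * u = v^-1 * l * u * k ^ u)%g.
      by rewrite conjgE !mulgA mulgK.
    exact: gpredMr.
  case: (stab u) => su.
    have := mem g' 1%g su; rewrite mul1g mulg1 gh (mem g' h' su) => ->.
    by do 2 case: (_ \in stab_in G xi); ring.
  have := mem h' 1%g su; rewrite mul1g mulg1 (mem h' g' su) => ->.
  by do 2 case: (_ \in stab_in G xi); ring.
(* Applied to the point mass at 1 and evaluated at 1, only the terms of 1 and of [g' * h'] can
   contribute, giving 1 or 2. *)
apply/eqP => lw0; have := lambdaE w (ind R [fset 1%g]%fset) 1%g.
rewrite lw0 !big_cons big_nil /= !mulg1 !inE !invg_eq1 eqxx (negPf g'1) (negPf h'1).
rewrite !mulr0 !add0r !mul1r addr0 => /eqP.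
by rewrite -[X in X == _]/(0 : R[i]) eq_sym -natrD pnatr_eq0.
Qed.
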